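(* Let $\mathbb X$ and $\mathbb Y$ be Banach spaces, $C\subseteq\mathbb X$ and $F:C\to\mathbb Y$ a continuous function, analytic on $\mathrm{int}(C)$. Take $x_0\in\mathrm{int}(C)$ with $F'(x_0)$ non-singular and define $\gamma:=\sup_{n>1}\big\|\frac{F'(x_0)^{-1}F^{(n)}(x_0)}{n!}\big\|^{1/(n-1)}$. Suppose $B(x_0,1/\gamma)\subset C$, $b>0$, and \[\|F'(x_0)^{-1}F(x_0)\|\le b,\qquad b\gamma<3-2\sqrt2,\qquad 0\le\theta\le\frac{1-2\sqrt{\gamma b}-\gamma b}{1+2\sqrt{\gamma b}+\gamma b}.\] Then the inexact Newton method with starting point $x_0$ and relative residual error tolerance $\theta$: for $k=0,1,\dots$, $x_{k+1}=x_k+S_k$ with $\|F'(x_0)^{-1}[F(x_k)+F'(x_k)S_k]\|\le\theta\|F'(x_0)^{-1}F(x_k)\|$, is well defined; any generated sequence $\{x_k\}$ converges to a zero $x_*$ of $F$, satisfies $\|F'(x_0)^{-1}F(x_k)\|\le(\frac{1+\theta^2}{2})^k b$ for $k=0,1,\dots$, and is contained in $B(x_0,\lambda)$; moreover $x_*\in B[x_0,t_*]$ and $x_*$ is the unique zero of $F$ in $B(x_0,\bar\tau)$, where \[\lambda:=\frac{b}{\sqrt{\gamma b}+\gamma b},\quad t_*:=\frac{1+\gamma b-\sqrt{1-6\gamma b+(\gamma b)^2}}{4\gamma},\quad \bar\tau:=\frac{1+\gamma b+\sqrt{1-6\gamma b+(\gamma b)^2}}{4\gamma}.\] Moreover, for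 $k=0,1,\dots$, \[\|x_*-x_{k+1}\|\le\Big[\frac{1+\theta}{2}\frac{D^-f'(\lambda)}{|f'(\lambda)|}\|x_*-x_k\|+\theta\,\frac{f'(\lambda)+2}{|f'(\lambda)|}\Big]\|x_*-x_k\|,\] and if additionally $0\le\theta<(1-2\sqrt{\gamma b}-\gamma b)/(5-2\sqrt{\gamma b}-\gamma b)$, then \[\|x_*-x_{k+1}\|\le\Big[\frac{1+\theta}{2}+\frac{2\theta}{1-2\sqrt{\gamma b}-\gamma b}\Big]\|x_*-x_k\|,\qquad k=0,1,\dots.\]
   Context: $B(x,r)$, $B[x,r]$ are open/closed balls. Here $f:[0,1/\gamma)\to\mathbb R$ is the function $f(t)=\frac{t}{1-\gamma t}-2t+b$, and $D^-f'(\lambda)$ is the left derivative of $f'$ at $\lambda$. *)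

(* Defs.v *)
From HB Require Import structures.
From mathcomp Require Import all_boot all_order all_algebra.
From mathcomp Require Import all_classical all_reals all_analysis.
Set Implicit Arguments. Unset Strict Implicit. Unset Printing Implicit Defensive.
Import Order.TTheory GRing.Theory Num.Theory.
Import numFieldNormedType.Exports.
Local Open Scope classical_set_scope.
Local Open Scope ring_scope.

Section Defs.
Context {R : realType} {X Y : normedModType R}.

Definition upd n (h : 'I_n -> X) (i : 'I_n) (w : X) : 'I_n -> X :=
  fun j => if j == i then w else h j.

Definition multilinear n (A : ('I_n -> X) -> Y) : Prop :=
  forall (h : 'I_n -> X) (i : 'I_n) (a : R) (u v : X),
    A (upd h i (a *: u + v)) = a *: A (upd h i u) + A (upd h i v).

Definition analytic_at (F : X -> Y) (x : X) : Prop :=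
  exists r : R, 0 < r /\
  exists (A : forall n, ('I_n -> X) -> Y) (M : nat -> R),
    (forall n, multilinear (A n)) /\
    (forall n, 0 <= M n) /\
    (forall n (h : 'I_n -> X), `|A n h| <= M n * \prod_(i < n) `|h i|) /\
    cvgn (series (fun n => M n * r ^+ n)) /\
    (forall h : X, `|h| < r ->
       series (fun n => A n (fun _ => h)) @ \oo --> F (x + h)).

Definition analytic_on (F : X -> Y) (U : set X) : Prop :=
  forall x, U x -> analytic_at F x.

(* n-th derivative F^{(n)}(x)[h_1,...,h_n] as iterated directional
   derivatives (hs = [:: h_1; ...; h_n]) *)
Fixpoint Dn (F : X -> Y) (hs : seq X) : X -> Y :=
  match hs with
  | [::] => F
  | h :: t => 'D_h (Dn F t)
  end.

Definition nlin_norm (L : Y -> X) (F : X -> Y) (x : X) (n : nat) : R :=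
  sup [set `|L (Dn F hs x)| / (n`!)%:R |
        hs in [set hs : seq X | size hs = n /\ all (fun h => `|h| <= 1) hs]].

(* Smale's gamma: sup_{n>1} || F'(x)^{-1} F^{(n)}(x) / n! ||^{1/(n-1)},
   where L = F'(x)^{-1} *)
Definition gamma_of (L : Y -> X) (F : X -> Y) (x : X) : R :=
  sup [set nlin_norm L F x n `^ (n.-1%:R)^-1 | n in [set n : nat | (1 < n)%N]].

(* one step of the inexact Newton method with relative residual tolerance
   theta, preconditioned by L = F'(x0)^{-1} *)
Definition inexact_step (L : Y -> X) (F : X -> Y) (theta : R) (xk xk1 : X) :=
  `|L (F xk + 'd F xk (xk1 - xk))| <= theta * `|L (F xk)|.

End Defs.

Definition fmaj {R : realType} (gamma b : R) (t : R) : R :=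
  t / (1 - gamma * t) - 2 * t + b.

Definition left_deriv {R : realType} (g : R -> R) (l : R) : R :=
  lim ((fun t => (g t - g l) / (t - l)) @ l^'-).

(* Main.v *)
(* Put G = F'(x0)^-1 o F.  The bounds defining gamma say that the polar forms
   c_n = F'(x0)^-1 F^(n)(x0) / n! satisfy ||c_n|| <= gamma^(n-1); a priori their
   series represents G only near x0, but both sides are analytic along each ray
   from x0, so by the one-variable identity theorem it represents G on the whole
   ball B(x0, 1/gamma).  (F'(x0)^-1 is bounded by the open mapping theorem.)
   Expanding c_n(x + u, ..., x + u) multilinearly and summing geometric series
   then shows that the linearization errors of G are dominated by those of the
   scalar majorant f.

   With a = sqrt(gamma b) and kappa = 1 - 2a - a^2 one has f(lambda) = - kappa lambda
   and f'(lambda) = - kappa.  The convergence proof follows x_k together with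
   scalars (t, e) such that |x_k - x0| <= t and |G(x_k)| <= f(t) + e, updated by
   t+ = t - (1 + theta)(f(t) + e)/f'(t) and e+ = e + 2 theta (f(t) + e).  The
   region 0 <= t < lambda, 0 <= e <= kappa t is invariant because f lies above its
   tangents, and convexity of f' makes f(t) + e decrease by the factor
   (1 + theta^2)/2 at each step. *)
Require Import Defs.
From HB Require Import structures.
From mathcomp Require Import all_boot all_order all_algebra.
From mathcomp Require Import all_classical all_reals all_analysis.
From mathcomp Require Import ring lra.
Import Order.TTheory GRing.Theory Num.Theory.
Import numFieldNormedType.Exports.
Local Open Scope classical_set_scope.
Local Open Scope ring_scope.

Set Implicit Arguments. Unset Strict Implicit. Unset Printing Implicit Defensive.

(** The Newton estimates use only the series of G centred at [x0]: the derivative of G at x is the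
    sum of the termwise derivatives at x - x0, and the Taylor and Lipschitz bounds are proved for
    each multilinear term by replacing one argument at a time, which takes the part of a mean value
    theorem and yields exactly the scalar expressions belonging to f. The number kappa is the
    maximum of -f(t)/t on (0, 1/gamma) and lambda is where it is attained: the tangent to f there
    passes through the origin. The bound on theta is used in the form 2 theta <= kappa (1 + theta),
    obtained by clearing the denominator 1 + 2a + a^2 = 2 - kappa. The scalar e is there because an
    inexact step leaves a residual of size up to theta |G(x_k)|, which the values of f alone do not
    follow. Adding 2 theta (f(t) + e) to e makes f(t+) + e+ equal to theta (f(t) + e) plus the
    second-order remainder of f, the same shape as the bound for |G(x_{k+1})|. *)

(** * Families of multilinear maps and their increments *)

Section MultilinearFamilies.
Context {R : realType} {X Y : normedModType R}.
Implicit Types (a : seq X -> Y) (s : seq X) (h k u v w : X).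

(* A family of multilinear maps, one for each arity, is coded as a single
   function on sequences; the arity is the size of the argument. *)
Definition mlin a := forall s1 s2 (c : R) u v,
  a (s1 ++ (c *: u + v) :: s2) = c *: a (s1 ++ u :: s2) + a (s1 ++ v :: s2).

(** One pair (K, g) serves all arities, so that freezing an argument x only multiplies K by g
    |x|. *)
Definition geo a (K g : R) :=
  forall s, `|a s| <= K * g ^+ size s * \prod_(h <- s) `|h|.

(* [del h a] is the derivative in the direction [h] of the family [a], the sum
   over all the ways of inserting [h] in the argument. *)
Fixpoint del h a s {struct s} : Y :=
  a (h :: s) + (if s is x :: s' then del h (fun t => a (x :: t)) s' else 0).

Lemma mlin_cons a x : mlin a -> mlin (fun t => a (x :: t)).
Proof. by move=> ma s1 s2 c u v; rewrite (ma (x :: s1)). Qed.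

Lemma mlinD a s1 s2 u v : mlin a ->
  a (s1 ++ (u + v) :: s2) = a (s1 ++ u :: s2) + a (s1 ++ v :: s2).
Proof. by move=> ma; have := ma s1 s2 1 u v; rewrite !scale1r. Qed.

Lemma mlin0 a s1 s2 : mlin a -> a (s1 ++ 0 :: s2) = 0.
Proof.
move=> ma; have := mlinD s1 s2 0 0 ma; rewrite addr0 => H.
by apply: (addrI (a (s1 ++ 0 :: s2))); rewrite -H addr0.
Qed.

Lemma mlinZ a s1 s2 c u : mlin a ->
  a (s1 ++ (c *: u) :: s2) = c *: a (s1 ++ u :: s2).
Proof. by move=> ma; have := ma s1 s2 c u 0; rewrite mlin0 // !addr0. Qed.

Lemma mlin_nseqZ a n c h : mlin a ->
  a (nseq n (c *: h)) = c ^+ n *: a (nseq n h).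
Proof.
elim: n a => [|n IH] a ma; first by rewrite expr0 scale1r.
rewrite /= (mlinZ [::]) //= (IH (fun t => a (h :: t))); last exact: mlin_cons.
by rewrite scalerA -exprS.
Qed.

Lemma eq_del h a a' s : a =1 a' -> del h a s = del h a' s.
Proof. by elim: s a a' => [|x s IH] a a' e /=; rewrite e // (IH _ _ (fun t => e (x :: t))). Qed.

Lemma del_lin h a a' c s :
  del h (fun t => c *: a t + a' t) s = c *: del h a s + del h a' s.
Proof.
elim: s a a' => [|x s IH] a a' /=; first by rewrite !addr0.
by rewrite IH scalerDr addrACA.
Qed.

Lemma del_dir a c u v s : mlin a ->
  del (c *: u + v) a s = c *: del u a s + del v a s.
Proof.
elim: s a => [|x s IH] a ma /=; rewrite (ma [::]) ?addr0 //=.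
by rewrite IH ?scalerDr 1?addrACA //; exact: mlin_cons.
Qed.

Lemma mlin_del a h : mlin a -> mlin (del h a).
Proof.
move=> ma s1; elim: s1 a ma => [|x s1 IH] a ma s2 c u v /=.
  rewrite (ma [:: h]) /= (@eq_del h _ (fun t => c *: a (u :: t) + a (v :: t))).
    by rewrite del_lin scalerDr addrACA.
  by move=> t; rewrite (ma [::]).
by rewrite IH 1?(ma (h :: x :: s1)) ?scalerDr 1?addrACA //; exact: mlin_cons.
Qed.

(** All n + 1 insertions give the same tuple; this is Euler's identity for homogeneous
    polynomials. *)
Lemma del_nseq a h n : del h a (nseq n h) = n.+1%:R *: a (nseq n.+1 h).
Proof.
elim: n a => [|n IH] a; first by rewrite /= addr0 scale1r.
rewrite [LHS]/= -[del _ _ _]/(del h (fun t => a (h :: t)) (nseq n h)) IH /=.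
by rewrite -[in RHS]natr1 scalerDl scale1r addrC.
Qed.

Lemma geo_cons a K g x : geo a K g -> geo (fun t => a (x :: t)) (K * g * `|x|) g.
Proof.
move=> ga s; have := ga (x :: s); rewrite big_cons exprS => /le_trans; apply.
by rewrite le_eqVlt; apply/orP; left; apply/eqP; ring.
Qed.

Lemma geo_nseq a K g n h : geo a K g -> `|a (nseq n h)| <= K * (g * `|h|) ^+ n.
Proof.
by move=> /(_ (nseq n h)); rewrite size_nseq big_nseq iter_mulr_1 exprMn mulrA.
Qed.

Lemma del_le a K g h s : geo a K g ->
  `|del h a s| <= K * (size s).+1%:R * g ^+ (size s).+1 * `|h| * \prod_(k <- s) `|k|.
Proof.
elim: s a K => [|x s IH] a K ga /=.
  by have := ga [:: h]; rewrite addr0 big_seq1 big_nil !mulr1.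
apply: le_trans (ler_normD _ _) _.
have := ga (h :: x :: s); have := IH _ _ (geo_cons x ga).
rewrite /= !big_cons => h1 h2; apply: le_trans (lerD h2 h1) _.
rewrite le_eqVlt; apply/orP; left; apply/eqP.
by rewrite -[in RHS]natr1 !exprS; ring.
Qed.

(** The number of insertions is absorbed by n + 1 <= 2^n, which doubles the ratio. *)
Lemma geo_del a K g h : 0 <= K -> 0 <= g -> geo a K g ->
  geo (del h a) (K * g * `|h|) (2 * g).
Proof.
move=> K0 g0 ga s; apply: le_trans (del_le h s ga) _.
have n0 : 0 <= \prod_(k <- s) `|k| by apply: prodr_ge0.
apply: ler_wpM2r => //.
have -> : K * (size s).+1%:R * g ^+ (size s).+1 * `|h| =
          K * g * `|h| * ((size s).+1%:R * g ^+ size s) by rewrite exprS; ring.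
apply: ler_wpM2l; first by rewrite !mulr_ge0.
by rewrite exprMn; apply: ler_wpM2r; rewrite ?exprn_ge0 // -natrX ler_nat ltn_expl.
Qed.

Lemma del_nseq_le a K g n h k : geo a K g ->
  `|del h a (nseq n k)| <= K * (g * `|h|) * (n.+1%:R * (g * `|k|) ^+ n).
Proof.
move=> /(del_le h (nseq n k)); rewrite size_nseq big_nseq iter_mulr_1.
move=> /le_trans; apply.
by rewrite le_eqVlt; apply/orP; left; apply/eqP; rewrite exprS exprMn; ring.
Qed.

(** Exchanging k for k + u one argument at a time costs no more than the increment of the scalar
    monomial z^n between g|k| and g|k| + g|u|. *)
Lemma mlin_diff_le a K g n k u : 0 <= K -> 0 <= g -> mlin a -> geo a K g ->
  `|a (nseq n (k + u)) - a (nseq n k)| <=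
  K * ((g * `|k| + g * `|u|) ^+ n - (g * `|k|) ^+ n).
Proof.
move=> K0 g0; elim: n a K K0 => [|n IH] a K K0 ma ga.
  by rewrite /= !expr0 !subrr normr0 mulr0.
have -> : a (nseq n.+1 (k + u)) - a (nseq n.+1 k) =
    (a (k :: nseq n (k + u)) - a (k :: nseq n k)) + a (u :: nseq n (k + u)).
  by rewrite /= (mlinD [::]) //= addrAC.
apply: le_trans (ler_normD _ _) _.
have Kk : 0 <= K * g * `|k| by rewrite !mulr_ge0.
have := IH _ _ Kk (mlin_cons k ma) (geo_cons k ga).
have := geo_nseq n (k + u) (geo_cons u ga).
move=> /= h1 h2; apply: le_trans (lerD h2 h1) _.
have h3 : (g * `|k + u|) ^+ n <= (g * `|k| + g * `|u|) ^+ n.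
  apply: lerXn2r; rewrite ?nnegrE ?mulr_ge0 ?addr_ge0 ?mulr_ge0 //.
  by rewrite -mulrDr ler_wpM2l // ler_normD.
have h4 : K * g * `|u| * (g * `|k + u|) ^+ n <=
          K * g * `|u| * (g * `|k| + g * `|u|) ^+ n.
  by apply: ler_wpM2l => //; rewrite !mulr_ge0.
apply: le_trans (lerD (lexx _) h4) _.
by rewrite le_eqVlt; apply/orP; left; apply/eqP; rewrite !exprS; ring.
Qed.

(** Peeling off the first argument leaves the same remainder with k frozen there, plus a first-order
    difference with u frozen there, to which [mlin_diff_le] applies. The bound is the remainder of
    the scalar monomial of degree n + 1. *)
Lemma mlin_taylor_le a K g n k u : 0 <= K -> 0 <= g -> mlin a -> geo a K g ->
  `|a (nseq n.+1 (k + u)) - a (nseq n.+1 k) - del u a (nseq n k)| <=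
  K * ((g * `|k| + g * `|u|) ^+ n.+1 - (g * `|k|) ^+ n.+1
       - n.+1%:R * (g * `|k|) ^+ n * (g * `|u|)).
Proof.
move=> K0 g0; elim: n a K K0 => [|n IH] a K K0 ma ga.
  rewrite /= (mlinD [::]) //= addr0 [a [:: k] + _]addrC addrK subrr normr0.
  by rewrite le_eqVlt; apply/orP; left; apply/eqP; ring.
have -> : a (nseq n.+2 (k + u)) - a (nseq n.+2 k) - del u a (nseq n.+1 k) =
    (a (k :: nseq n.+1 (k + u)) - a (k :: nseq n.+1 k)
       - del u (fun t => a (k :: t)) (nseq n k))
    + (a (u :: nseq n.+1 (k + u)) - a (u :: nseq n.+1 k)).
  rewrite [nseq n.+2 _]/= (mlinD [::]) //=.
  set x := a (k :: k + u :: _); set y := a (u :: k + u :: _).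
  set z := a (k :: _); set w := a (u :: _); set d := del _ _ _.
  by rewrite opprD [RHS]addrACA [x + y - z]addrAC [- w - d]addrC.
apply: le_trans (ler_normD _ _) _.
have Kk : 0 <= K * g * `|k| by rewrite !mulr_ge0.
have Ku : 0 <= K * g * `|u| by rewrite !mulr_ge0.
have h2 := IH _ _ Kk (mlin_cons k ma) (geo_cons k ga).
have h1 := mlin_diff_le n.+1 k u Ku g0 (mlin_cons u ma) (geo_cons u ga).
move: h1 h2 => /= h1 h2; apply: le_trans (lerD h2 h1) _.
rewrite le_eqVlt; apply/orP; left; apply/eqP.
by rewrite -[in n.+2%:R]natr1 !exprS; ring.
Qed.

(** Telescoping over the n + 1 arguments: each exchange of x for y contributes a factor |y - x| and
    leaves n arguments of norm at most t. *)
Lemma mlin_lip_le a K g n x y (t : R) : 0 <= K -> 0 <= g -> mlin a -> geo a K g ->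
  `|x| <= t -> `|y| <= t ->
  `|a (nseq n.+1 y) - a (nseq n.+1 x)| <=
  K * (g * `|y - x|) * (n.+1%:R * (g * t) ^+ n).
Proof.
move=> K0 g0 + + xt yt; have t0 : 0 <= t by apply: le_trans xt.
elim: n a K K0 => [|n IH] a K K0 ma ga.
  have <- : a [:: y - x] = a [:: y] - a [:: x].
    by apply/eqP; rewrite -subr_eq opprK -(mlinD [::] [::]) //= subrK.
  have := geo_nseq 1 (y - x) ga; rewrite expr1 => /le_trans; apply.
  by rewrite le_eqVlt; apply/orP; left; apply/eqP; ring.
have -> : a (nseq n.+2 y) - a (nseq n.+2 x) =
    (a (y :: nseq n.+1 y) - a (y :: nseq n.+1 x)) + a ((y - x) :: nseq n.+1 x).
  have -> : a (y - x :: nseq n.+1 x) = a (y :: nseq n.+1 x) - a (x :: nseq n.+1 x).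
    by apply/eqP; rewrite -subr_eq opprK -(mlinD [::]) //= subrK.
  by rewrite addrA subrK.
apply: le_trans (ler_normD _ _) _.
have Ky : 0 <= K * g * `|y| by rewrite !mulr_ge0.
have := IH _ _ Ky (mlin_cons y ma) (geo_cons y ga).
have := geo_nseq n.+1 x (geo_cons (y - x) ga).
move=> /= h1 h2; apply: le_trans (lerD h2 h1) _.
have h3 : K * g * `|y| * (g * `|y - x|) * (n.+1%:R * (g * t) ^+ n) <=
    K * g * t * (g * `|y - x|) * (n.+1%:R * (g * t) ^+ n).
  apply: ler_wpM2r; first by rewrite !mulr_ge0 ?exprn_ge0 // mulr_ge0.
  by apply: ler_wpM2r; rewrite ?mulr_ge0 // ler_wpM2l // mulr_ge0.
have h4 : K * g * `|y - x| * (g * `|x|) ^+ n.+1 <= K * g * `|y - x| * (g * t) ^+ n.+1.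
  apply: ler_wpM2l; first by rewrite !mulr_ge0.
  by apply: lerXn2r; rewrite ?nnegrE ?mulr_ge0 // ler_wpM2l.
apply: le_trans (lerD h3 h4) _.
rewrite le_eqVlt; apply/orP; left; apply/eqP.
by rewrite -[in n.+2%:R]natr1 !exprS; ring.
Qed.

End MultilinearFamilies.

(** * Partial sums of the geometric series and of its increments *)

Section GeometricSums.
Context {R : realType}.
Implicit Types p q : R.

Lemma sum_geo_le p N : 0 <= p -> p < 1 -> \sum_(i < N) p ^+ i <= (1 - p)^-1.
Proof.
move=> p0 p1; have p1' : 0 < 1 - p by rewrite subr_gt0.
elim: N => [|N IH]; first by rewrite big_ord0 invr_ge0 ltW.
rewrite big_ord_recl expr0.
under eq_bigr do rewrite lift0 exprS.
rewrite -mulr_sumr; apply: le_trans (lerD (lexx _) (ler_wpM2l p0 IH)) _.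
by rewrite le_eqVlt; apply/orP; left; apply/eqP; field; rewrite gt_eqF.
Qed.

Lemma sum_dgeo_le p N : 0 <= p -> p < 1 ->
  \sum_(i < N) i.+1%:R * p ^+ i <= (1 - p)^-2.
Proof.
move=> p0 p1; have p1' : 0 < 1 - p by rewrite subr_gt0.
elim: N => [|N IH]; first by rewrite big_ord0 invr_ge0 exprn_ge0 ?ltW.
have -> : \sum_(i < N.+1) i.+1%:R * p ^+ i =
    \sum_(i < N.+1) p ^+ i + p * (\sum_(i < N) i.+1%:R * p ^+ i).
  rewrite mulr_sumr.
  have -> : \sum_(i < N) p * (i.+1%:R * p ^+ i) = \sum_(i < N.+1) i%:R * p ^+ i.
    by rewrite big_ord_recl mul0r add0r; apply: eq_bigr => i _; rewrite lift0 exprS; ring.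
  by rewrite -big_split; apply: eq_bigr => i _; rewrite -natr1 /=; ring.
apply: le_trans (lerD (sum_geo_le N.+1 p0 p1) (ler_wpM2l p0 IH)) _.
by rewrite le_eqVlt; apply/orP; left; apply/eqP; field; rewrite gt_eqF.
Qed.

Lemma sum_diff_le p q N : 0 <= p -> 0 <= q -> p + q < 1 ->
  \sum_(i < N) ((p + q) ^+ i - p ^+ i) <= q / ((1 - p) * (1 - p - q)).
Proof.
move=> p0 q0 pq; have ? : 0 < 1 - p by lra.
have ? : 0 < 1 - p - q by lra.
elim: N => [|N IH]; first by rewrite big_ord0 divr_ge0 // mulr_ge0 ?ltW.
rewrite big_ord_recl !expr0 subrr add0r.
have -> : \sum_(i < N) ((p + q) ^+ lift ord0 i - p ^+ lift ord0 i) =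
    p * (\sum_(i < N) ((p + q) ^+ i - p ^+ i)) + q * (\sum_(i < N) (p + q) ^+ i).
  rewrite !mulr_sumr -big_split; apply: eq_bigr => i _.
  by rewrite lift0 !exprS /=; ring.
have pq0 : 0 <= p + q by lra.
apply: le_trans (lerD (ler_wpM2l p0 IH) (ler_wpM2l q0 (sum_geo_le N pq0 pq))) _.
rewrite le_eqVlt; apply/orP; left; apply/eqP; field.
by apply/andP; split; rewrite gt_eqF //; lra.
Qed.

(** The right-hand side is the second-order remainder of 1/(1 - z) between p and p + q. Splitting
    off one factor p gives a recursion whose inhomogeneous term is controlled by [sum_diff_le]. *)
Lemma sum_taylor_le p q N : 0 <= p -> 0 <= q -> p + q < 1 ->
  \sum_(i < N) ((p + q) ^+ i.+1 - p ^+ i.+1 - i.+1%:R * p ^+ i * q) <=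
  q ^+ 2 / ((1 - p) ^+ 2 * (1 - p - q)).
Proof.
move=> p0 q0 pq; have ? : 0 < 1 - p by lra.
have ? : 0 < 1 - p - q by lra.
elim: N => [|N IH].
  by rewrite big_ord0 divr_ge0 ?exprn_ge0 // mulr_ge0 ?exprn_ge0 ?ltW.
rewrite big_ord_recl !expr1 expr0 !mul1r.
have -> : \sum_(i < N) ((p + q) ^+ (lift ord0 i).+1 - p ^+ (lift ord0 i).+1
      - (lift ord0 i).+1%:R * p ^+ lift ord0 i * q) =
    p * (\sum_(i < N) ((p + q) ^+ i.+1 - p ^+ i.+1 - i.+1%:R * p ^+ i * q))
    + q * (\sum_(i < N.+1) ((p + q) ^+ i - p ^+ i)).
  rewrite big_ord_recl !expr0 subrr add0r !mulr_sumr -big_split.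
  apply: eq_bigr => i _.
  by rewrite !lift0 -[in i.+2%:R]natr1 !exprS /=; ring.
have -> : p + q - p - q = 0 by ring.
rewrite add0r.
apply: le_trans (lerD (ler_wpM2l p0 IH) (ler_wpM2l q0 (sum_diff_le N.+1 p0 q0 pq))) _.
rewrite le_eqVlt; apply/orP; left; apply/eqP; field.
by rewrite ?mulf_neq0 ?gt_eqF.
Qed.

End GeometricSums.

(** * Dominated series, and differentiability from a quadratic remainder *)

Section BanachSeries.
Context {R : realType}.

Lemma lim_norm_le (Y : normedModType R) (u : nat -> Y) l (B : R) :
  u @ \oo --> l -> (forall n, `|u n| <= B) -> `|l| <= B.
Proof.
move=> ul uB; have nl : `|u n| @[n --> \oo] --> `|l| by exact: cvg_norm.
rewrite -(cvg_lim (@Rhausdorff R) nl).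
by apply: limr_le; [apply/cvg_ex; exists `|l| | exact: nearW].
Qed.

Lemma series_dominated (Y : completeNormedModType R) (u : nat -> Y)
    (v : nat -> R) (B : R) :
  (forall n, `|u n| <= v n) -> (forall N, \sum_(i < N) v i <= B) ->
  cvgn (series u) /\ `|limn (series u)| <= B.
Proof.
move=> uv vB.
have sB N : \sum_(0 <= i < N) `|u i| <= B.
  by rewrite big_mkord; apply: le_trans (vB N); apply: ler_sum.
have cu : cvgn (series u).
  apply: normed_cvg; apply: nondecreasing_is_cvgn.
    by apply: nondecreasing_series => i _ _; exact: normr_ge0.
  by exists B => _ [N _ <-]; exact: sB.
split=> //; apply: (lim_norm_le cu) => N.
by apply: le_trans (sB N); exact: ler_norm_sum.
Qed.

Lemma differentiable_of_taylor (V W : normedModType R) (F : V -> W) (x : V)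
    (T : {linear V -> W}) (M C d : R) : 0 < d ->
  (forall u, `|T u| <= M * `|u|) ->
  (forall u, `|u| < d -> `|F (x + u) - F x - T u| <= C * `|u| ^+ 2) ->
  differentiable F x /\ 'd F x = T :> (V -> W).
Proof.
move=> d0 TM FT.
have Tc : continuous T.
  apply: bounded_linear_continuous; apply/linear_boundedP.
  exists M; split; first exact: num_real.
  by move=> r Mr v; apply: le_trans (TM v) _; rewrite ler_wpM2r // ltW.
have dF : F \o shift x = cst (F x) + T +o_ 0 id.
  apply/eqaddoP => e e0.
  have eC : 0 < e / (`|C| + 1) by rewrite divr_gt0 // ltr_wpDl.
  near=> u.
  have ud : `|u| < d by near: u; exact: cvgr0_norm_lt.
  have -> : (F \o shift x - (cst (F x) + T)) u = F (x + u) - F x - T u.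
    by rewrite /= !fctE /= opprD addrA [u + x]addrC.
  apply: le_trans (FT u ud) _.
  have uC : `|u| < e / (`|C| + 1) by near: u; exact: cvgr0_norm_lt.
  rewrite expr2 mulrA; apply: ler_wpM2r => //.
  have := ltW uC; rewrite ler_pdivlMr; last by rewrite ltr_wpDl.
  apply: le_trans; rewrite mulrC; apply: ler_wpM2l => //.
  by apply: le_trans (ler_norm C) _; rewrite lerDl.
have dT := diff_unique Tc dF.
split=> //; apply/diff_locallyP; rewrite dT; split=> //.
Unshelve. all: by end_near.
Qed.

End BanachSeries.

(** * Power series in a Banach space and their termwise derivatives *)

Section PowerSeries.
Context {R : realType} {X : normedModType R} {Y : completeNormedModType R}.
Implicit Types (a : seq X -> Y) (s : seq X) (h k u v w x : X) (F : X -> Y).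

(** As a limit this is meaningful only where the series converges, which [geo a K g] ensures for g
    |h| < 1. *)
Definition psat a h : Y := limn (series (fun n => a (nseq n h))).

Lemma psat_cvg a K g h : 0 <= K -> 0 <= g -> geo a K g -> g * `|h| < 1 ->
  series (fun n => a (nseq n h)) @ \oo --> psat a h.
Proof.
move=> K0 g0 ga gh.
have := @series_dominated R Y (fun n => a (nseq n h))
  (fun n => K * (g * `|h|) ^+ n) (K * (1 - g * `|h|)^-1).
case=> // [n|N]; first exact: geo_nseq.
by rewrite -mulr_sumr ler_wpM2l // sum_geo_le // mulr_ge0.
Qed.

Lemma del_series_cvg a K g u k : 0 <= K -> 0 <= g -> geo a K g ->
  g * `|k| < 1 ->
  series (fun n => del u a (nseq n k)) @ \oo --> psat (del u a) k /\
  `|psat (del u a) k| <= K * (g * `|u|) / (1 - g * `|k|) ^+ 2.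
Proof.
move=> K0 g0 ga gk.
have := @series_dominated R Y (fun n => del u a (nseq n k))
  (fun n => K * (g * `|u|) * (n.+1%:R * (g * `|k|) ^+ n))
  (K * (g * `|u|) / (1 - g * `|k|) ^+ 2).
case=> [n|N|//]; first exact: del_nseq_le.
by rewrite -mulr_sumr ler_wpM2l ?sum_dgeo_le // !mulr_ge0.
Qed.

Lemma psat_del_lin a K g k c u v : 0 <= K -> 0 <= g -> mlin a -> geo a K g ->
  g * `|k| < 1 ->
  psat (del (c *: u + v) a) k = c *: psat (del u a) k + psat (del v a) k.
Proof.
move=> K0 g0 ma ga gk.
have [cu _] := del_series_cvg u K0 g0 ga gk.
have [cv _] := del_series_cvg v K0 g0 ga gk.
apply: cvg_lim; first exact: norm_hausdorff.
have -> : series (fun n => del (c *: u + v) a (nseq n k)) =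
    c \*: series (fun n => del u a (nseq n k)) + series (fun n => del v a (nseq n k)).
  apply: funext => N.
  rewrite -[RHS]/(c *: (series _ N) + series _ N) /series /= scaler_sumr -big_split.
  apply: eq_bigr => i _ /=.
  by rewrite del_dir.
by apply: cvgD => //; exact: cvgZl_tmp.
Qed.

Lemma psat_taylor_le a K g k u : 0 <= K -> 0 <= g -> mlin a -> geo a K g ->
  g * `|k| + g * `|u| < 1 ->
  `|psat a (k + u) - psat a k - psat (del u a) k| <=
  K * ((g * `|u|) ^+ 2 / ((1 - g * `|k|) ^+ 2 * (1 - g * `|k| - g * `|u|))).
Proof.
move=> K0 g0 ma ga gku.
have gk0 : 0 <= g * `|k| by rewrite mulr_ge0.
have gu0 : 0 <= g * `|u| by rewrite mulr_ge0.
have gk : g * `|k| < 1 by apply: le_lt_trans gku; rewrite lerDl.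
have gku' : g * `|k + u| < 1.
  by apply: le_lt_trans gku; rewrite -mulrDr ler_wpM2l // ler_normD.
have c1 := psat_cvg K0 g0 ga gku'; have c2 := psat_cvg K0 g0 ga gk.
have [c3 _] := del_series_cvg u K0 g0 ga gk.
(* The derivative of the term of degree n + 1 is the n-th term of the [del] series, hence the shift;
   the terms of degree 0 cancel. *)
rewrite -(cvg_shiftS _) in c1; rewrite -(cvg_shiftS _) in c2.
apply: (lim_norm_le (cvgB (cvgB c1 c2) c3)) => N /=.
rewrite /series /= !fctE /= !big_mkord !big_ord_recl /=.
rewrite [X in `|X|](_ : _ = \sum_(i < N) (a (nseq i.+1 (k + u))
    - a (nseq i.+1 k) - del u a (nseq i k))); last first.
  by rewrite !sumrB opprD addrACA subrr add0r.
apply: le_trans (ler_norm_sum _ _ _) _.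
set p := g * `|k|; set q := g * `|u|.
apply: (@le_trans _ _ (\sum_(i < N)
    K * ((p + q) ^+ i.+1 - p ^+ i.+1 - i.+1%:R * p ^+ i * q))).
  by apply: ler_sum => i _; exact: mlin_taylor_le.
by rewrite -mulr_sumr ler_wpM2l // sum_taylor_le.
Qed.

Lemma psat_lip_le a K g x y (t : R) : 0 <= K -> 0 <= g -> mlin a -> geo a K g ->
  `|x| <= t -> `|y| <= t -> g * t < 1 ->
  `|psat a y - psat a x - a [:: y - x]| <=
  K * (g * `|y - x|) * ((1 - g * t) ^-2 - 1).
Proof.
move=> K0 g0 ma ga xt yt gt; have t0 : 0 <= t by apply: le_trans xt.
have gy : g * `|y| < 1 by apply: le_lt_trans gt; rewrite ler_wpM2l.
have gx : g * `|x| < 1 by apply: le_lt_trans gt; rewrite ler_wpM2l.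
have c1 := psat_cvg K0 g0 ga gy; have c2 := psat_cvg K0 g0 ga gx.
(* Degrees 0 and 1 drop out of the difference, so the sum starts in degree 2; this is the source of
   the -1 in the bound. *)
rewrite -(cvg_shiftn 2) in c1; rewrite -(cvg_shiftn 2) in c2.
apply: (lim_norm_le (cvgB (cvgB c1 c2) (cvg_cst (a [:: y - x])))) => N /=.
rewrite /series /= !fctE /= !addn2 !big_mkord !big_ord_recl /=.
have -> : a [:: y - x] = a [:: y] - a [:: x].
  by apply/eqP; rewrite -subr_eq opprK -(mlinD [::] [::]) //= subrK.
rewrite [X in `|X|](_ : _ = \sum_(i < N) (a (nseq i.+2 y)
    - a (nseq i.+2 x))); last first.
  rewrite !sumrB opprD addrACA subrr add0r opprD addrACA.
  by rewrite [a [:: y] - a [:: x] + _]addrC addrK.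
apply: le_trans (ler_norm_sum _ _ _) _.
apply: (@le_trans _ _ (\sum_(i < N)
    K * (g * `|y - x|) * (i.+2%:R * (g * t) ^+ i.+1))).
  by apply: ler_sum => i _; exact: mlin_lip_le.
rewrite -mulr_sumr ler_wpM2l ?mulr_ge0 // lerBrDl.
apply: le_trans (sum_dgeo_le N.+1 _ gt); last by rewrite mulr_ge0.
by rewrite big_ord_recl expr0 mulr1 lerD2l; under [X in _ <= X]eq_bigr do rewrite lift0.
Qed.

Lemma psat_del_le a K g u k : 0 <= K -> 0 <= g -> geo a K g ->
  g * `|k| < 1 ->
  `|psat (del u a) k - a [:: u]| <= K * (g * `|u|) * ((1 - g * `|k|) ^-2 - 1).
Proof.
move=> K0 g0 ga gk.
have [c1 _] := del_series_cvg u K0 g0 ga gk.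
rewrite -(cvg_shiftS _) in c1.
apply: (lim_norm_le (cvgB c1 (cvg_cst (a [:: u])))) => N /=.
rewrite /series /= !fctE /= !big_mkord !big_ord_recl /= addr0.
rewrite [a _ + _]addrC addrK; apply: le_trans (ler_norm_sum _ _ _) _.
apply: (@le_trans _ _ (\sum_(i < N)
    K * (g * `|u|) * (i.+2%:R * (g * `|k|) ^+ i.+1))).
  by apply: ler_sum => i _; exact: (del_nseq_le i.+1 u k ga).
rewrite -mulr_sumr ler_wpM2l ?mulr_ge0 // lerBrDl.
apply: le_trans (sum_dgeo_le N.+1 _ gk); last by rewrite mulr_ge0.
by rewrite big_ord_recl expr0 mulr1 lerD2l; under [X in _ <= X]eq_bigr do rewrite lift0.
Qed.

Lemma psat0 a : mlin a -> psat a 0 = a [::].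
Proof.
move=> ma; apply: cvg_lim; first exact: norm_hausdorff.
rewrite -(cvg_shiftS _); apply: cvg_near_cst; apply: nearW => N.
rewrite /series /= big_mkord big_ord_recl big1 ?addr0 // => i _.
by rewrite /= (mlin0 [::]).
Qed.

(** The condition r g <= 1 keeps the ball on which F is represented inside the region of convergence
    provided by [geo]. *)
Definition expands F x a (K g r : R) :=
  [/\ 0 <= K, 0 < g, 0 < r & r * g <= 1] /\
  [/\ mlin a, geo a K g & forall h, `|h| < r -> F (x + h) = psat a h].

Lemma expands_diff F x a K g r k : expands F x a K g r -> `|k| < r ->
  differentiable F (x + k) /\ forall u, 'd F (x + k) u = psat (del u a) k.
Proof.
move=> [[K0 g0 r0 rg] [ma ga Fa]] kr.
have gk1 : g * `|k| < 1.
  by apply: lt_le_trans rg; rewrite mulrC ltr_pM2r.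
have g0' := ltW g0.
have Tlin : linear (fun u => psat (del u a) k).
  by move=> c u v; apply: (psat_del_lin (K := K) (g := g)).
pose T : {linear X -> Y} := HB.pack (fun u => psat (del u a) k)
  (GRing.isLinear.Build R X Y _ (fun u => psat (del u a) k) Tlin).
set p := g * `|k|; have p0 : 0 <= p by rewrite mulr_ge0.
(* Within this radius x + k + u stays in the ball of the expansion, and 1 - p - g |u| stays above (1
   - p)/2, which makes the remainder quadratic with a fixed constant. *)
pose d := Num.min (r - `|k|) ((1 - p) / 2 / g).
have p1 : 0 < (1 - p) / 2 by rewrite divr_gt0 // subr_gt0.
have d0 : 0 < d by rewrite lt_min subr_gt0 kr /= divr_gt0.
have [||F1 F2] := @differentiable_of_taylor R X Y F (x + k) T
   (K * g / (1 - p) ^+ 2) (K * g ^+ 2 / ((1 - p) ^+ 2 * ((1 - p) / 2))) d d0.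
- move=> u; have [_ /le_trans] := del_series_cvg u K0 g0' ga gk1; apply.
  by rewrite le_eqVlt; apply/orP; left; apply/eqP; ring.
- move=> u; rewrite lt_min => /andP[ud1 ud2].
  have gu : g * `|u| < (1 - p) / 2 by rewrite mulrC -ltr_pdivlMr.
  have ku : `|k + u| < r.
    by apply: le_lt_trans (ler_normD _ _) _; rewrite -ltrBrDl.
  rewrite -[x + k + u]addrA (Fa _ ku) (Fa _ kr).
  have pq : p + g * `|u| < 1 by lra.
  apply: le_trans (psat_taylor_le K0 g0' ma ga pq) _.
  have -> : K * g ^+ 2 / ((1 - p) ^+ 2 * ((1 - p) / 2)) * `|u| ^+ 2 =
    K * ((g * `|u|) ^+ 2 * ((1 - p) ^+ 2 * ((1 - p) / 2))^-1) by ring.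
  have q1 : 0 < 1 - p by rewrite subr_gt0.
  have q2 : 0 < 1 - p - g * `|u| by lra.
  rewrite -/p; rewrite ler_wpM2l // ler_wpM2l ?exprn_ge0 ?mulr_ge0 //.
  rewrite lef_pV2 ?posrE ?mulr_gt0 ?exprn_gt0 //.
  by rewrite ler_pM2l ?exprn_gt0 //; lra.
by split=> // u; rewrite F2.
Qed.

(** The radius is halved to match the doubled ratio in [geo_del]; all that matters later is that
    some positive radius survives each differentiation. *)
Lemma expands_derive F x a K g r h : expands F x a K g r ->
  expands ('D_h F) x (del h a) (K * g * `|h|) (2 * g) (r / 2).
Proof.
move=> H; have [[K0 g0 r0 rg] [ma ga Fa]] := H; split; split.
- by rewrite !mulr_ge0 // ltW.
- by rewrite mulr_gt0.
- by rewrite divr_gt0.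
- by rewrite mulrA divfK.
- exact: mlin_del.
- by apply: geo_del => //; exact: ltW.
- move=> k kr; have kr' : `|k| < r by apply: lt_trans kr _; lra.
  have [dF dE] := expands_diff H kr'.
  by rewrite deriveE // dE.
Qed.

Lemma expands_Dn F x a K g r hs : expands F x a K g r ->
  exists K' g' r', expands (Dn F hs) x (foldr del a hs) K' g' r'.
Proof.
move=> H; elim: hs => [|h hs [K' [g' [r' IH]]]]; first by exists K, g, r.
by exists (K' * g' * `|h|), (2 * g'), (r' / 2); exact: expands_derive.
Qed.

Lemma expands_Dn_at F x a K g r hs : expands F x a K g r ->
  Dn F hs x = foldr del a hs [::].
Proof.
move=> /(expands_Dn hs)[K' [g' [r' [[_ _ r0 _] [ma _ Fa]]]]].
by rewrite -(psat0 ma) -Fa ?normr0 // addr0.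
Qed.

End PowerSeries.

(** * Iterated derivatives at the centre as polar forms *)

Section PolarForms.
Context {R : realType} {X Y : normedModType R}.
Implicit Types (a : seq X -> Y) (s : seq X) (h k u v w x : X).

Lemma mlin_foldr_del a hs : mlin a -> mlin (foldr del a hs).
Proof. by move=> ma; elim: hs => //= h hs IH; exact: mlin_del. Qed.

Lemma foldr_del_lin a s1 s2 c u v t : mlin a ->
  foldr del a (s1 ++ (c *: u + v) :: s2) t =
  c *: foldr del a (s1 ++ u :: s2) t + foldr del a (s1 ++ v :: s2) t.
Proof.
move=> ma; elim: s1 t => [|x s1 IH] t /=.
  by rewrite del_dir //; exact: mlin_foldr_del.
by rewrite (eq_del _ _ IH) del_lin.
Qed.

(** Differentiating a term of degree n + m in its own direction m times produces the factor (n +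
    m)!/n!. The arity n is kept general because each [del] raises it by one in the induction. *)
Lemma foldr_del_nseq a n m h :
  n`!%:R *: foldr del a (nseq m h) (nseq n h) = (n + m)`!%:R *: a (nseq (n + m) h).
Proof.
elim: m n => [|m IH] n; first by rewrite addn0.
by rewrite /= del_nseq scalerA mulrC -natrM -factS IH addSnnS.
Qed.

Lemma polar_nseq a m h : foldr del a (nseq m h) [::] = m`!%:R *: a (nseq m h).
Proof. by have := foldr_del_nseq a 0 m h; rewrite scale1r. Qed.

(** The constants depend on the number of directions only; this uniformity makes the suprema in
    [nlin_norm] finite. *)
Lemma geo_foldr_del a K g n : 0 <= K -> 0 < g -> geo a K g ->
  exists K' g', [/\ 0 <= K', 0 < g' & forall hs, size hs = n ->
    all (fun h => `|h| <= 1) hs -> geo (foldr del a hs) K' g'].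
Proof.
move=> K0 g0 ga; elim: n => [|n [K' [g' [K0' g0' IH]]]].
  by exists K, g; split=> // -[].
exists (K' * g'), (2 * g'); split; [|by rewrite mulr_gt0|].
  by rewrite mulr_ge0 // ltW.
case=> // h hs [/IH {}IH] /= /andP[h1 /IH {}IH] s.
apply: le_trans (geo_del h K0' (ltW g0') IH s) _.
apply: ler_wpM2r; first exact: prodr_ge0.
apply: ler_wpM2r; first by rewrite exprn_ge0 // mulr_ge0 // ltW.
by rewrite ler_piMr // mulr_ge0 // ltW.
Qed.

Lemma polar_bounded a K g n : 0 <= K -> 0 < g -> geo a K g ->
  exists B, forall hs, size hs = n -> all (fun h => `|h| <= 1) hs ->
    `|foldr del a hs [::]| <= B.
Proof.
move=> K0 g0 ga; have [K' [g' [_ _ H]]] := geo_foldr_del n K0 g0 ga.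
exists K' => hs sn h1; have := H hs sn h1 [::].
by rewrite big_nil expr0 !mulr1.
Qed.

End PolarForms.

(** The terms M n r^n of a convergent series are bounded by some K, so the maps satisfy a geometric
    bound with ratio 1/r. *)
Lemma analytic_at_expands (R : realType) (X : normedModType R)
    (Y : completeNormedModType R) (F : X -> Y) x : analytic_at F x ->
  exists a K g r, expands F x a K g r.
Proof.
move=> [r [r0 [A [M [mA [M0 [AM [cM FA]]]]]]]].
pose a' n (hs : seq X) := A n (fun i : 'I_n => nth 0 hs i).
pose a hs := a' (size hs) hs.
have [K Kb] : exists K, forall n, M n * r ^+ n <= K.
  have /cvg_series_bounded [K0 [_ /(_ (K0 + 1))]] := cM.
  rewrite ltrDl => /(_ ltr01) H; exists (K0 + 1) => n.
  by apply: le_trans (ler_norm _) (H n I).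
have K0 : 0 <= K by apply: le_trans (Kb 0%N); rewrite expr0 mulr1.
have gea : geo a K r^-1.
  move=> s; apply: le_trans (AM _ _) _.
  have -> : \prod_(i < size s) `|nth 0 s i| = \prod_(h <- s) `|h|.
    by rewrite (big_nth 0) big_mkord.
  apply: ler_wpM2r; first exact: prodr_ge0.
  by rewrite exprVn ler_pdivlMr ?exprn_gt0.
have an n h : a (nseq n h) = A n (fun _ => h).
  rewrite /a size_nseq /a'; congr (A n _); apply: funext => i.
  by rewrite nth_nseq ltn_ord.
exists a, K, r^-1, r; split; split => //.
- by rewrite invr_gt0.
- by rewrite mulfV // gt_eqF.
- move=> s1 s2 c u v; rewrite /a.
  have sz w : size (s1 ++ w :: s2) = (size s1 + (size s2).+1)%N by rewrite size_cat.
  rewrite !sz; set n := (_ + _)%N.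
  have i0 : (size s1 < n)%N by rewrite /n addnS ltnS leq_addr.
  have E w : a' n (s1 ++ w :: s2) =
      A n (upd (fun i : 'I_n => nth 0 (s1 ++ 0 :: s2) i) (Ordinal i0) w).
    rewrite /a'; congr (A n _); apply: funext => i; rewrite /upd.
    case: eqP => [->|/eqP ni]; first by rewrite /= nth_cat ltnn subnn.
    have {}ni : (i : nat) != size s1 by apply: contra ni => /eqP e; apply/eqP/val_inj.
    rewrite !nth_cat; case: ltnP => // le; case E : (i - size s1)%N => //.
    by move/eqP: E; rewrite subn_eq0 => ge; rewrite eqn_leq le ge in ni.
  by rewrite !E mA.
- move=> h hr; have := FA h hr => /(cvg_lim (@norm_hausdorff _ _)) <-.
  by rewrite /psat; congr (limn (series _)); apply: funext => n; rewrite an.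
Qed.

(** * Approximate solutions, bounded inverses and Neumann series *)

Section ApproximateSolutions.
Context {R : realType}.

(** The residual is corrected again and again; it decays like q^n, so the corrections sum as a
    geometric series. *)
Lemma surjective_of_approx (X : completeNormedModType R) (Y : normedModType R)
    (T : {linear X -> Y}) (C q : R) :
  continuous T -> 0 <= C -> 0 <= q -> q < 1 ->
  (forall y, exists x, `|x| <= C * `|y| /\ `|y - T x| <= q * `|y|) ->
  forall y, exists x, T x = y /\ `|x| <= C * `|y| / (1 - q).
Proof.
move=> Tc C0 q0 q1 /choice[phi phiP] y.
pose res := fix res n := if n is m.+1 then res m - T (phi (res m)) else y.
have resq n : `|res n| <= q ^+ n * `|y|.
  elim: n => [|n IH]; first by rewrite expr0 mul1r.
  rewrite /= exprS -mulrA; apply: le_trans (phiP (res n)).2 _.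
  by rewrite ler_wpM2l.
pose u n := phi (res n).
have [||cu ub] := @series_dominated R X u (fun n => C * `|y| * q ^+ n)
    (C * `|y| / (1 - q)).
- move=> n; apply: le_trans (phiP (res n)).1 _.
  by rewrite -mulrA [`|y| * _]mulrC ler_wpM2l.
- by move=> N; rewrite -mulr_sumr ler_wpM2l ?mulr_ge0 // sum_geo_le.
exists (limn (series u)); split=> //.
have c1 : T (series u n) @[n --> \oo] --> T (limn (series u)).
  by apply: cvg_comp cu _; exact: Tc.
have TE n : T (series u n) = y - res n.
  elim: n => [|n IH]; first by rewrite /series /= big_geq // linear0 subrr.
  by rewrite seriesSr linearD IH /= opprB addrA addrAC.
have c2 : T (series u n) @[n --> \oo] --> y.
  under eq_fun do rewrite TE.
  suff : (y - res n) @[n --> \oo] --> y - 0 by rewrite subr0.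
  apply: cvgB; first exact: cvg_cst.
  apply/norm_cvg0P; apply: (@squeeze_cvgr _ _ _ _ (fun=> 0) (fun n => q ^+ n * `|y|)).
  - by apply: nearW => n; rewrite normr_ge0 resq.
  - exact: cvg_cst.
  - rewrite -[X in _ --> X](mul0r `|y|); apply: cvgMl.
    by apply: cvg_expr; rewrite ger0_norm.
exact: (cvg_unique (@norm_hausdorff _ _) c1 c2).
Qed.

(** By Baire's theorem some set of y with |L y| <= n is dense in a ball. Differences of such points
    give approximate preimages with a fixed bound, [surjective_of_approx] makes them exact, and
    injectivity of T identifies them with the values of L. *)
Lemma bounded_inverse (X Y : completeNormedModType R) (T : {linear X -> Y})
    (L : Y -> X) : continuous T -> cancel T L -> cancel L T ->
  exists B, 0 <= B /\ forall y, `|L y| <= B * `|y|.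
Proof.
move=> Tc TL LT.
have LB y z : L (y - z) = L y - L z by apply: (can_inj TL); rewrite linearB !LT.
have LZ c y : L (c *: y) = c *: L y by apply: (can_inj TL); rewrite linearZ /= !LT.
pose A n := closure [set y : Y | `|L y| <= n%:R].
have [n [y0 [d [d0 By0]]]] : exists n y0 (d : R), 0 < d /\ ball y0 d `<=` A n.
  apply: contrapT => H.
  have opd i : open (~` A i) /\ dense (~` A i).
    split; first by apply: closed_openC; exact: closed_closure.
    move=> O [y Oy] oO; apply: contrapT => H'; apply: H.
    have /nbhs_ballP[d /= d0 dO] : nbhs y O by exact: open_nbhs_nbhs.
    exists i, y, d; split=> // z /dO Oz; apply: contrapT => nA.
    by apply: H'; exists z.
  have [y [_ yA]] := Baire opd (ex_intro _ 0 I : [set: Y] !=set0) openT.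
  have /= := yA (Num.bound `|L y|) I; apply; apply: subset_closure => /=.
  by apply/ltW/archi_boundP.
have approx y : exists x, `|x| <= (4 * n%:R / d) * `|y| /\ `|y - T x| <= 2^-1 * `|y|.
  have [->|yN0] := eqVneq y 0.
    by exists 0; rewrite linear0 subr0 !normr0 !mulr0.
  have ny : 0 < `|y| by rewrite normr_gt0.
  (* The scale gives t |y| = d/2, so y0 + t y lies in the ball; the two approximation errors d/8 add
     up to d/4, which is half of t |y|. *)
  pose t := d / (2 * `|y|); have t0 : 0 < t by rewrite divr_gt0 // mulr_gt0.
  have ty : t * `|y| = d / 2 by rewrite /t; field; rewrite gt_eqF.
  have close z : A n z -> exists w, `|L w| <= n%:R /\ `|z - w| < d / 8.
    move=> /(_ (ball z (d / 8))) [].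
      by apply: nbhsx_ballx; rewrite divr_gt0.
    by move=> w [Lw zw]; exists w; split=> //; move: zw; rewrite -ball_normE.
  have [z1 [L1 yz1]] : exists w, `|L w| <= n%:R /\ `|y0 + t *: y - w| < d / 8.
    apply: close; apply: By0; rewrite -ball_normE /= opprD addrA subrr add0r normrN normrZ.
    by rewrite (gtr0_norm t0) ty; lra.
  have [z2 [L2 yz2]] := close y0 (By0 _ (ballxx _ d0)).
  exists (L (t^-1 *: (z1 - z2))); rewrite LT LZ LB; split.
    rewrite normrZ gtr0_norm ?invr_gt0 // -ler_pdivlMl ?invr_gt0 // invrK.
    apply: le_trans (ler_normB _ _) _; apply: le_trans (lerD L1 L2) _.
    rewrite le_eqVlt; apply/orP; left; apply/eqP.
    by rewrite mulrCA ty; field; rewrite gt_eqF.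
  have -> : y - t^-1 *: (z1 - z2) = t^-1 *: ((y0 + t *: y - z1) - (y0 - z2)).
    have -> : y0 + t *: y - z1 - (y0 - z2) = t *: y - (z1 - z2).
      rewrite !opprB -[y0 + _ - z1]addrA [y0 + _]addrC [z2 - y0]addrC addrA addrK.
      by rewrite [z2 - z1]addrC addrA.
    by rewrite [RHS]scalerBr scalerA mulVf ?scale1r // gt_eqF.
  rewrite normrZ gtr0_norm ?invr_gt0 // -ler_pdivlMl ?invr_gt0 // invrK.
  apply: le_trans (ler_normB _ _) _.
  by rewrite mulrCA ty; lra.
have d4 : 0 <= 4 * n%:R / d by rewrite divr_ge0 ?mulr_ge0 // ltW.
have h0 : 0 <= 2^-1 :> R by rewrite invr_ge0.
have h1 : 2^-1 < 1 :> R by rewrite invf_lt1 // ltr1n.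
have H := surjective_of_approx Tc d4 h0 h1 approx.
exists (4 * n%:R / d / (1 - 2^-1)); split.
  by rewrite divr_ge0 // subr_ge0 ltW.
move=> y; have [x [<- /le_trans]] := H y; rewrite TL; apply.
by rewrite mulrAC.
Qed.

(** For T close to the identity, z itself solves T x = z up to a relative residual q. *)
Lemma neumann (X : completeNormedModType R) (T : {linear X -> X}) (q : R) :
  continuous T -> 0 <= q -> q < 1 -> (forall h, `|T h - h| <= q * `|h|) ->
  forall y, exists x, T x = y.
Proof.
move=> Tc q0 q1 Tq y.
have [//||x [Tx _]] := @surjective_of_approx X X T 1 q Tc _ q0 q1 _ y.
  by move=> z; exists z; rewrite mul1r distrC.
by exists x.
Qed.

End ApproximateSolutions.

(** * The identity theorem for vector-valued functions of one real variable *)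

Section IdentityTheorem.
Context {R : realType} {Y : completeNormedModType R}.
Implicit Types (f : R -> Y) (c : nat -> Y) (s t u : R).

Definition locps f s := exists (c : nat -> Y) (K g r : R),
  [/\ 0 <= K, 0 < g, 0 < r & r * g <= 1] /\
  (forall n, `|c n| <= K * g ^+ n) /\
  forall u, `|u| < r -> series (fun n => u ^+ n *: c n) @ \oo --> f (s + u).

Lemma locpsB f f' s : locps f s -> locps f' s -> locps (fun t => f t - f' t) s.
Proof.
move=> [c [K [g [r [[K0 g0 r0 rg] [cK cf]]]]]].
move=> [c' [K' [g' [r' [[K0' g0' r0' rg'] [cK' cf']]]]]].
exists (fun n => c n - c' n), (K + K'), (Num.max g g'), (Num.min r r').
split; first split.
- exact: addr_ge0.
- by rewrite lt_max g0.
- by rewrite lt_min r0.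
- case: (leP g g') => _.
    by apply: le_trans rg'; rewrite ler_wpM2r ?ge_min ?lexx ?orbT // ltW.
  by apply: le_trans rg; rewrite ler_wpM2r ?ge_min ?lexx // ltW.
split=> [n|u].
  apply: le_trans (ler_normB _ _) _; rewrite mulrDl; apply: lerD.
    apply: le_trans (cK n) _; rewrite ler_wpM2l //.
    by apply: lerXn2r; rewrite ?nnegrE ?le_max ?lexx // ltW.
  apply: le_trans (cK' n) _; rewrite ler_wpM2l //.
  by apply: lerXn2r; rewrite ?nnegrE ?le_max ?lexx ?orbT // ltW.
rewrite lt_min => /andP[/cf c1 /cf' c2].
have -> : series (fun n => u ^+ n *: (c n - c' n)) =
    series (fun n => u ^+ n *: c n) - series (fun n => u ^+ n *: c' n).
  apply: funext => N; rewrite -[RHS]/(series _ N - series _ N) /series /= -sumrB.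
  by apply: eq_bigr => i _; rewrite scalerBr.
exact: cvgB.
Qed.

Lemma bin_term_le (s v : R) n j : 0 <= s -> 0 <= v ->
  s ^+ (n - j) * v ^+ j * 'C(n, j)%:R <= (s + v) ^+ n.
Proof.
move=> s0 v0; case: (leqP j n) => jn; last first.
  by rewrite bin_small // mulr0 exprn_ge0 // addr_ge0.
rewrite mulr_natr exprDn (bigD1 (Ordinal (n := n.+1) (m := j) jn)) //=.
rewrite lerDl sumr_ge0 // => i _.
by rewrite mulrn_wge0 // mulr_ge0 // exprn_ge0.
Qed.

(** Re-expansion at s by the binomial theorem. The interchange of sums is carried out on N by N
    squares: the N-th partial sums of the two series differ by O(z^N). *)
Lemma locps_recenter f c (K g s : R) : 0 <= K -> 0 < g -> 0 <= s -> g * s < 1 ->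
  (forall n, `|c n| <= K * g ^+ n) ->
  (forall t, g * `|t| < 1 -> series (fun n => t ^+ n *: c n) @ \oo --> f t) ->
  locps f s.
Proof.
move=> K0 g0 s0 gs cK cf.
(* With this v the number z = g (s + v) is the midpoint of g s and 1, so powers of z dominate the
   double series and are summable. *)
pose v : R := (1 - g * s) / 2 / g.
have v0 : 0 < v by rewrite !divr_gt0 // subr_gt0.
pose z := g * (s + v).
have zE : z = (1 + g * s) / 2 by rewrite /z /v; field; rewrite gt_eqF.
have z0 : 0 <= z by rewrite mulr_ge0 ?addr_ge0 // ltW.
have z1 : z < 1 by rewrite zE; lra.
pose e j n := (s ^+ (n - j) * 'C(n, j)%:R) *: c n.
have eK j n : `|e j n| <= K / v ^+ j * z ^+ n.
  rewrite normrZ ger0_norm; last by rewrite mulr_ge0 // exprn_ge0.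
  rewrite [K / _ * _]mulrAC ler_pdivlMr ?exprn_gt0 //.
  have -> : s ^+ (n - j) * 'C(n, j)%:R * `|c n| * v ^+ j =
      s ^+ (n - j) * v ^+ j * 'C(n, j)%:R * `|c n| by ring.
  have -> : K * z ^+ n = (s + v) ^+ n * (K * g ^+ n) by rewrite /z exprMn; ring.
  apply: ler_pM => //; last by rewrite bin_term_le // ltW.
  by rewrite !mulr_ge0 // exprn_ge0 // ltW.
pose d j := limn (series (e j)).
have edP j : series (e j) @ \oo --> d j /\ `|d j| <= K / (1 - z) * v^-1 ^+ j.
  have [||ce eb] := @series_dominated R Y (e j) (fun n => K / v ^+ j * z ^+ n)
     (K / v ^+ j / (1 - z)); first exact: eK.
    move=> N; rewrite -mulr_sumr ler_wpM2l ?divr_ge0 ?exprn_ge0 ?sum_geo_le //.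
    exact: ltW.
  by split=> //; apply: le_trans eb _; rewrite exprVn mulrAC.
have tail j N : `|d j - series (e j) N| <= K / v ^+ j * (z ^+ N / (1 - z)).
  have [ce _] := edP j; rewrite -(cvg_shiftn N) in ce.
  apply: (lim_norm_le (cvgB ce (cvg_cst (series (e j) N)))) => M /=.
  rewrite [X in `|X|](_ : _ = \sum_(i < M) e j (N + i)%N); last first.
    rewrite -[LHS]/(series (e j) (M + N)%N - series (e j) N) addnC.
    rewrite sub_series_geq ?leq_addr //.
    by rewrite -{1}[N]add0n big_addn addKn big_mkord; apply: eq_bigr => i _; rewrite addnC.
  apply: le_trans (ler_norm_sum _ _ _) _.
  apply: (@le_trans _ _ (\sum_(i < M) K / v ^+ j * z ^+ N * z ^+ i)).
    by apply: ler_sum => i _; apply: le_trans (eK _ _) _; rewrite exprD mulrA.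
  rewrite -mulr_sumr mulrA ler_wpM2l ?sum_geo_le //.
  by rewrite mulr_ge0 ?exprn_ge0 // divr_ge0 // exprn_ge0 // ltW.
exists d, (K / (1 - z)), v^-1, v; split; first split => //.
- by rewrite divr_ge0 // subr_ge0 ltW.
- by rewrite invr_gt0.
- by rewrite mulfV // gt_eqF.
split=> [j|u uv]; first by have [] := edP j.
have su : g * `|s + u| < 1.
  apply: le_lt_trans z1; rewrite /z ler_wpM2l //; first exact: ltW.
  apply: le_trans (ler_normD _ _) _.
  by rewrite ger0_norm // lerD2l ltW.
(* The partial sum fills the whole square j, n < N, because the entries with j > n carry a vanishing
   binomial coefficient. *)
have pE N : series (fun n => (s + u) ^+ n *: c n) N =
    \sum_(j < N) u ^+ j *: series (e j) N.
  rewrite /series /= big_mkord.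
  under [RHS]eq_bigr do rewrite big_mkord scaler_sumr.
  rewrite exchange_big /=; apply: eq_bigr => n _.
  rewrite exprDn scaler_suml.
  have -> : \sum_(j < N) u ^+ j *: e j n =
      \sum_(j < N) (fun j : nat => (s ^+ (n - j) * u ^+ j *+ 'C(n, j)) *: c n) j.
    apply: eq_bigr => j _; rewrite /e scalerA; congr (_ *: _).
    by rewrite -mulr_natr; ring.
  rewrite (big_ord_widen N (fun j => (s ^+ (n - j) * u ^+ j *+ 'C(n, j)) *: c n)) //.
  rewrite big_mkcond; apply: eq_bigr => j _.
  by case: ltnP => // nj; rewrite bin_small // mulr0n scale0r.
pose rho : R := `|u| / v.
have rho0 : 0 <= rho by rewrite divr_ge0 // ltW.
have rho1 : rho < 1 by rewrite ltr_pdivrMr // mul1r.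
have close N : `|series (fun n => u ^+ n *: d n) N
    - series (fun n => (s + u) ^+ n *: c n) N| <= K / (1 - z) / (1 - rho) * z ^+ N.
  rewrite pE {1}/series /= big_mkord -sumrB.
  apply: le_trans (ler_norm_sum _ _ _) _.
  apply: (@le_trans _ _ (\sum_(i < N) K * z ^+ N / (1 - z) * rho ^+ i)).
    apply: ler_sum => i _; rewrite -scalerBr normrZ normrX.
    apply: le_trans (ler_wpM2l _ (tail i N)) _; first by rewrite exprn_ge0.
    rewrite le_eqVlt; apply/orP; left; apply/eqP.
    by rewrite /rho [(`|u| / v) ^+ i]exprMn [v^-1 ^+ i]exprVn; ring.
  rewrite -mulr_sumr.
  have -> : K / (1 - z) / (1 - rho) * z ^+ N = K * z ^+ N / (1 - z) / (1 - rho) by ring.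
  rewrite ler_wpM2l ?sum_geo_le // divr_ge0 ?mulr_ge0 ?exprn_ge0 //.
  by rewrite subr_ge0 ltW.
have cz : K / (1 - z) / (1 - rho) * z ^+ N @[N --> \oo] --> 0.
  rewrite -[X in _ --> X](mulr0 (K / (1 - z) / (1 - rho))); apply: cvgMr.
  by apply: cvg_expr; rewrite ger0_norm.
have c0 : (series (fun n => u ^+ n *: d n) N
    - series (fun n => (s + u) ^+ n *: c n) N) @[N --> \oo] --> 0.
  apply/norm_cvg0P; apply: (squeeze_cvgr _ (cvg_cst 0) cz).
  by apply: nearW => N; rewrite normr_ge0 close.
rewrite -[f _]add0r (_ : series _ = fun N =>
    (series (fun n => u ^+ n *: d n) N - series (fun n => (s + u) ^+ n *: c n) N)
    + series (fun n => (s + u) ^+ n *: c n) N); last first.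
  by apply: funext => N; rewrite subrK.
by apply: cvgD => //; exact: cf.
Qed.

(** If c_0, ..., c_(m-1) vanish, then at u = -t the term t^m |c_m| equals the norm of the tail,
    which is O(t^(m+1)); letting t tend to 0 gives c_m = 0. *)
Lemma locps_zero f s (eta : R) : locps f s -> 0 < eta ->
  (forall u, - eta < u -> u < 0 -> f (s + u) = 0) ->
  exists2 r : R, 0 < r & forall u : R, `|u| < r -> f (s + u) = 0.
Proof.
move=> [c [K [g [r [[K0 g0 r0 rg] [cK cf]]]]]] eta0 f0.
have c0 m : c m = 0.
  elim/ltn_ind: m => m IH.
  pose d := Num.min (Num.min r eta) (2 * g)^-1.
  have d0 : 0 < d by rewrite !lt_min r0 eta0 invr_gt0 mulr_gt0.
  have bnd (t : R) : 0 < t -> t < d -> `|c m| <= 2 * K * g ^+ m.+1 * t.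
    move=> t0; rewrite !lt_min -andbA => /and3P[tr te tg].
    have nt : `|- t| = t by rewrite normrN gtr0_norm.
    have ft : f (s - t) = 0 by apply: f0; rewrite ?ltrN2 // oppr_lt0.
    have := cf (- t); rewrite nt ft => /(_ tr) ct.
    have gt : g * t <= 2^-1.
      by move: (ltW tg); rewrite invfM ler_pdivlMr // mulrC.
    rewrite -(cvg_shiftn m.+1) in ct.
    have := lim_norm_le (cvgB ct (cvg_cst ((- t) ^+ m *: c m)))
      (B := K * (g * t) ^+ m.+1 * 2).
    rewrite sub0r normrN normrZ normrX nt => H.
    have {}H : t ^+ m * `|c m| <= K * (g * t) ^+ m.+1 * 2.
      apply: H => M /=; rewrite [X in `|X|](_ : _ =
        \sum_(i < M) (- t) ^+ (m.+1 + i) *: c (m.+1 + i)%N); last first.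
        rewrite -[LHS]/(series _ (M + m.+1)%N - _) /series /= addnC.
        rewrite big_mkord big_split_ord /= big_ord_recr /= big1 ?add0r.
          by rewrite addrAC subrr add0r.
        by move=> i _; rewrite IH ?scaler0.
      apply: le_trans (ler_norm_sum _ _ _) _.
      apply: (@le_trans _ _ (\sum_(i < M) K * (g * t) ^+ m.+1 * (g * t) ^+ i)).
        apply: ler_sum => i _; rewrite normrZ normrX nt.
        apply: le_trans (ler_wpM2l _ (cK _)) _; first by rewrite exprn_ge0 // ltW.
        by rewrite le_eqVlt; apply/orP; left; apply/eqP; rewrite !exprMn !exprD; ring.
      rewrite -mulr_sumr ler_wpM2l //.
        by rewrite mulr_ge0 // exprn_ge0 // mulr_ge0 // ltW.
      have gt0 : 0 <= g * t by rewrite mulr_ge0 // ltW.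
      apply: le_trans (sum_geo_le M gt0 _) _; first by lra.
      rewrite -[X in _ <= X]invrK lef_pV2 ?posrE; lra.
    rewrite -(ler_pM2l (exprn_gt0 m t0)); apply: le_trans H _.
    by rewrite le_eqVlt; apply/orP; left; apply/eqP; rewrite exprMn !exprS; ring.
  apply/eqP; rewrite -normr_le0; apply/ler_addgt0Pr => e e0; rewrite add0r.
  pose t := Num.min (d / 2) (e / (2 * K * g ^+ m.+1 + 1)).
  have Kg : 0 <= 2 * K * g ^+ m.+1 by rewrite !mulr_ge0 // exprn_ge0 // ltW.
  have t0 : 0 < t by rewrite lt_min !divr_gt0 // ltr_wpDl.
  have td : t < d by rewrite gt_min; apply/orP; left; lra.
  apply: le_trans (bnd _ t0 td) _.
  have te : t * (2 * K * g ^+ m.+1 + 1) <= e.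
    by rewrite -ler_pdivlMr ?ltr_wpDl // ge_min lexx orbT.
  by move: te; rewrite mulrDr mulr1 mulrC; lra.
exists r => // u /cf; rewrite (_ : (fun n => _) = fun=> 0); last first.
  by apply: funext => n; rewrite c0 scaler0.
move=> cu; apply: (cvg_unique (@norm_hausdorff _ _) cu).
apply: cvg_near_cst; apply: nearW => N; rewrite /series /= big1 //.
Qed.

(** Let s0 be the supremum of the t up to which f vanishes. Then f vanishes to the left of s0, hence
    on a neighbourhood by [locps_zero], so s0 < S would contradict the supremum; the same
    neighbourhood covers S when s0 = S. *)
Lemma identity_theorem f (S eta : R) : 0 < S -> 0 < eta ->
  (forall s, 0 <= s -> s <= S -> locps f s) ->
  (forall u, 0 <= u -> u < eta -> f u = 0) -> f S = 0.
Proof.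
move=> S0 eta0 fl f0.
pose E := [set t | 0 <= t /\ t <= S /\ forall s, 0 <= s -> s <= t -> f s = 0].
have Eub : ubound E S by move=> t [_ []].
have E0 : E (Num.min (eta / 2) S).
  split; first by rewrite le_min !ltW // divr_gt0.
  split; first by rewrite ge_min lexx orbT.
  move=> s s0; rewrite le_min => /andP[s1 _]; apply: f0 => //; lra.
have hE : has_sup E by split; [exists (Num.min (eta / 2) S) | exists S].
pose s0 := sup E.
have s0p : 0 < s0.
  apply: lt_le_trans (ub_le_sup hE.2 E0).
  by rewrite lt_min divr_gt0.
have s0S : s0 <= S by apply: ge_sup => //; exact: hE.1.
have fs s : 0 <= s -> s < s0 -> f s = 0.
  move=> sge slt; have [t Et st] := sup_gt hE.1 slt.
  by apply: Et.2.2 => //; exact: ltW.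
have [|||r r0 fr] := @locps_zero f s0 s0.
- by apply: fl => //; exact: ltW.
- by [].
- by move=> u u1 u2; apply: fs; lra.
have Emin : E (Num.min (s0 + r / 2) S).
  split; first by rewrite le_min (ltW S0) andbT addr_ge0 // ltW // divr_gt0.
  split; first by rewrite ge_min lexx orbT.
  move=> s sge; rewrite le_min => /andP[s1 _].
  case: (ltP s s0) => [|s2]; first exact: fs.
  by rewrite -[s](subrKC s0) fr // ger0_norm ?subr_ge0 //; lra.
have := ub_le_sup hE.2 Emin; rewrite -/s0 ge_min => /orP[h|Ss0].
  by exfalso; move: h r0; clear; lra.
have -> : S = s0 + 0 by rewrite addr0; apply/eqP; rewrite eq_le Ss0 s0S.
by rewrite fr // normr0.
Qed.

End IdentityTheorem.

(** * The expansion of F'(x0)^-1 o F on the ball of radius 1/gamma *)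

Section NormalizedExpansion.
Context {R : realType}.

(** The arguments are normalized one after the other; s1 collects those already in the unit ball. *)
Lemma mlin_unit_bound (X Y : normedModType R) (c : seq X -> Y) (M : R) n s :
  mlin c ->
  (forall t, size t = n -> all (fun h => `|h| <= 1) t -> `|c t| <= M) ->
  size s = n -> `|c s| <= M * \prod_(h <- s) `|h|.
Proof.
move=> mc cM sn.
suff H s1 s2 : all (fun h => `|h| <= 1) s1 -> (size s1 + size s2)%N = n ->
    `|c (s1 ++ s2)| <= M * \prod_(h <- s2) `|h| by exact: (H [::]).
elim: s2 s1 => [|x s2 IH] s1 u1 e.
  rewrite big_nil mulr1 cats0; apply: cM => //.
  by rewrite -e addn0.
have [->|x0] := eqVneq x 0; first by rewrite mlin0 // big_cons !normr0 mul0r mulr0.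
have nx : 0 < `|x| by rewrite normr_gt0.
have -> : x = `|x| *: (`|x|^-1 *: x) by rewrite scalerA mulfV ?scale1r // gt_eqF.
rewrite mlinZ // normrZ normr_id big_cons normrZ normr_id.
have n1 : `| `|x|^-1 *: x| = 1.
  by rewrite normrZ ger0_norm ?invr_ge0 // mulVf // gt_eqF.
rewrite n1 mulr1 mulrCA ler_pM2l // -cat_rcons; apply: IH.
  by rewrite all_rcons u1 n1 lexx.
by rewrite size_rcons -e addSnnS.
Qed.

(* The supremum defining gamma is finite since its junk value 0 is excluded;
   the inner suprema are finite because the polar forms are bounded. *)
Lemma gamma_bound (X Y : completeNormedModType R) (F : X -> Y) (x0 : X)
    (L : {linear Y -> X}) (B : R) (a : seq X -> Y) (K g r : R) n hs :
  expands F x0 a K g r -> 0 <= B -> (forall y, `|L y| <= B * `|y|) ->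
  0 < gamma_of L F x0 -> (1 < n)%N -> size hs = n ->
  `|L (foldr del a hs [::])| / n`!%:R <=
  gamma_of L F x0 ^+ n.-1 * \prod_(h <- hs) `|h|.
Proof.
move=> H B0 LB g0 n1 sn.
have [[K0 g1 _ _] [ma ga _]] := H.
have fn0 : 0 < n`!%:R :> R by rewrite ltr0n fact_gt0.
pose c hs := n`!%:R^-1 *: L (foldr del a hs [::]).
have nc s : `|c s| = `|L (foldr del a s [::])| / n`!%:R.
  by rewrite normrZ ger0_norm ?invr_ge0 ?ltW // mulrC.
have mc : mlin c.
  move=> s1 s2 k u v; rewrite /c foldr_del_lin // linearP scalerDr !scalerA.
  by congr (_ *: _ + _); rewrite mulrC.
rewrite -nc; apply: (@mlin_unit_bound _ _ _ _ n) => // t tn t1.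
have [M HM] := polar_bounded n K0 g1 ga.
pose S := [set `|L (Dn F hs x0)| / (n`!)%:R |
        hs in [set hs : seq X | size hs = n /\ all (fun h => `|h| <= 1) hs]].
have Sub : has_ubound S.
  exists (B * M / n`!%:R) => _ [u [un u1] <-].
  rewrite (expands_Dn_at u H) ler_wpM2r // ?invr_ge0 ?(ltW fn0) //.
  by apply: le_trans (LB _) _; rewrite ler_wpM2l // HM.
have St : S `|c t| by exists t => //; rewrite nc (expands_Dn_at t H).
have h1 := ub_le_sup Sub St.
have N0 : 0 <= nlin_norm L F x0 n by apply: le_trans h1.
apply: le_trans h1 _.
have hs2 : has_sup [set nlin_norm L F x0 n `^ (n.-1%:R)^-1 | n in [set n : nat | (1 < n)%N]].
  by apply: contrapT => /sup_out e; move: g0; rewrite /gamma_of e ltxx.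
have h2 : nlin_norm L F x0 n `^ (n.-1%:R)^-1 <= gamma_of L F x0.
  by apply: (ub_le_sup hs2.2); exists n.
have nm : n.-1%:R != 0 :> R by rewrite pnatr_eq0 -lt0n -subn1 subn_gt0.
have -> : sup S = (nlin_norm L F x0 n `^ (n.-1%:R)^-1) ^+ n.-1.
  by rewrite -powR_mulrn ?powR_ge0 // -powRrM mulVf // powRr1.
by apply: lerXn2r; rewrite ?nnegrE ?powR_ge0 // ltW.
Qed.

Lemma locps_ray (X Y Z : completeNormedModType R) (F : X -> Y) (x h : X) (s : R)
    (L : {linear Y -> Z}) (B : R) :
  analytic_at F (x + s *: h) -> continuous L -> 0 <= B ->
  (forall y, `|L y| <= B * `|y|) -> locps (fun t => L (F (x + t *: h))) s.
Proof.
move=> /analytic_at_expands[a [K [g [r [[K0 g0 r0 rg] [ma ga Fa]]]]]] Lc B0 LB.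
(* Using |h| + 1 instead of |h| avoids a division by zero when h = 0. *)
have h1 : 0 < `|h| + 1 by rewrite ltr_wpDl.
exists (fun n => L (a (nseq n h))), (B * K), (g * (`|h| + 1)), (r / (`|h| + 1)).
split; first split.
- exact: mulr_ge0.
- exact: mulr_gt0.
- exact: divr_gt0.
- have -> : r / (`|h| + 1) * (g * (`|h| + 1)) = r * g by field; rewrite gt_eqF.
  by [].
split=> [n|u].
  apply: le_trans (LB _) _; rewrite -mulrA ler_wpM2l //.
  apply: le_trans (geo_nseq n h ga) _; rewrite ler_wpM2l //.
  apply: lerXn2r; rewrite ?nnegrE ?mulr_ge0 //; try exact: ltW.
  by rewrite ler_wpM2l ?lerDl // ltW.
rewrite ltr_pdivlMr // => ur.
have uh : `|u *: h| < r.
  rewrite normrZ; apply: le_lt_trans ur; by rewrite ler_wpM2l ?lerDl.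
have guh : g * `|u *: h| < 1.
  by apply: lt_le_trans rg; rewrite mulrC ltr_pM2r.
rewrite scalerDl addrA Fa //.
have ca := psat_cvg K0 (ltW g0) ga guh.
have -> : series (fun n => u ^+ n *: L (a (nseq n h))) =
    L \o series (fun n => a (nseq n (u *: h))).
  apply: funext => N; rewrite /series /= linear_sum; apply: eq_bigr => i _.
  by rewrite mlin_nseqZ // linearZ.
by apply: cvg_comp ca _; exact: Lc.
Qed.

Lemma locps_psat (X Z : completeNormedModType R) (c : seq X -> Z) (K g s : R) (h : X) :
  0 <= K -> 0 < g -> h != 0 -> 0 <= s -> g * (s * `|h|) < 1 -> mlin c -> geo c K g ->
  locps (fun t => psat c (t *: h)) s.
Proof.
move=> K0 g0 h0 s0 gsh mc gc.
apply: (@locps_recenter R Z _ (fun n => c (nseq n h)) K (g * `|h|)) => //.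
- by rewrite mulr_gt0 // normr_gt0.
- by rewrite mulrAC -mulrA.
- by move=> n; exact: geo_nseq.
- move=> t gt.
  have -> : (fun n => t ^+ n *: c (nseq n h)) = (fun n => c (nseq n (t *: h))).
    by apply: funext => n; rewrite mlin_nseqZ.
  apply: (psat_cvg K0 (ltW g0) gc).
  by rewrite normrZ [`|t| * _]mulrC mulrA.
Qed.

(** The bound gamma^(n-1) on the form of degree n comes from the definition of gamma for n > 1, from
    L F'(x0) = id for n = 1, and from gamma |L F(x0)| <= 1 for n = 0. *)
Lemma normalized_expansion (X Y : completeNormedModType R) (F : X -> Y) (x0 : X)
    (L : {linear Y -> X}) :
  let gamma := gamma_of L F x0 in
  0 < gamma -> (forall x, ball x0 gamma^-1 x -> analytic_at F x) ->
  continuous L -> (forall h, L ('d F x0 h) = h) -> gamma * `|L (F x0)| <= 1 ->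
  exists c : seq X -> X, [/\ mlin c, geo c gamma^-1 gamma,
    forall h, c [:: h] = h, c [::] = L (F x0) &
    forall h, `|h| < gamma^-1 -> L (F (x0 + h)) = psat c h].
Proof.
move=> gamma gm0 Fan Lc LF b1.
have gi0 : 0 < gamma^-1 by rewrite invr_gt0.
have [a [K [g [r H]]]] := analytic_at_expands (Fan x0 (ballxx _ gi0)).
have [[K0 g0 r0 rg] [ma ga Fa]] := H.
have [B [B0 LB]] : exists B, 0 <= B /\ forall y, `|L y| <= B * `|y|.
  have /linear_boundedP[M [_ MB]] := continuous_linear_bounded 0 (Lc 0).
  exists (`|M| + 1); split; first exact: addr_ge0.
  by apply: MB; apply: le_lt_trans (ler_norm M) _; rewrite ltrDl.
pose c hs := (size hs)`!%:R^-1 *: L (foldr del a hs [::]) : X.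
have fE n : n`!%:R != 0 :> R by rewrite pnatr_eq0 -lt0n fact_gt0.
have mc : mlin c.
  move=> s1 s2 k u v; rewrite /c !size_cat /= foldr_del_lin // linearP scalerDr.
  by rewrite !scalerA; congr (_ *: _ + _); rewrite mulrC.
have c1 h : c [:: h] = h.
  rewrite /c [size _]/= (_ : 1`! = 1)%N // invr1 scale1r /= addr0 -[RHS]LF; congr (L _).
  have n0 : `|0 : X| < r by rewrite normr0.
  have [_] := expands_diff H n0; rewrite addr0 => ->.
  by rewrite psat0 /= ?addr0 //; exact: mlin_del.
have c0 : c [::] = L (F x0).
  by rewrite /c [size _]/= fact0 invr1 scale1r -(expands_Dn_at [::] H).
have gc : geo c gamma^-1 gamma.
  move=> s; case sE : (size s) => [|[|n]].
  - move/eqP: sE; rewrite size_eq0 => /eqP ->; rewrite c0 big_nil expr0 !mulr1.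
    by rewrite -[X in _ <= X]mulr1 ler_pdivlMl.
  - case: s sE => [//|h [|//]] _.
    by rewrite c1 big_seq1 expr1 mulVf ?mul1r // gt_eqF.
  - have := gamma_bound H B0 LB gm0 (isT : (1 < n.+2)%N) sE.
    rewrite /c sE normrZ ger0_norm ?invr_ge0 // mulrC => /le_trans; apply.
    by rewrite [gamma ^+ n.+2]exprS mulKf // gt_eqF.
have cn n h : c (nseq n h) = L (a (nseq n h)).
  by rewrite /c size_nseq polar_nseq linearZ scalerA mulVf // scale1r.
have near0 k : `|k| < r -> gamma * `|k| < 1 -> L (F (x0 + k)) = psat c k.
  move=> kr gk; rewrite Fa //.
  have gk1 : g * `|k| < 1 by apply: lt_le_trans rg; rewrite mulrC ltr_pM2r.
  have ca := psat_cvg K0 (ltW g0) ga gk1.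
  have cL : (L \o series (fun n => a (nseq n k))) @ \oo --> L (psat a k).
    by apply: cvg_comp ca _; exact: Lc.
  apply/esym/cvg_lim; first exact: norm_hausdorff.
  have -> : series (fun n => c (nseq n k)) = L \o series (fun n => a (nseq n k)).
    by apply: funext => N; rewrite /series /= linear_sum; apply: eq_bigr => i _; rewrite cn.
  exact: cL.
exists c; split=> // h hg.
have ghh : gamma * `|h| < 1 by rewrite -ltr_pdivlMl // mulr1.
have [->|h0] := eqVneq h 0; first by rewrite addr0 psat0 ?c0.
have nh : 0 < `|h| by rewrite normr_gt0.
(* Both terms are locally power series in t along the segment from 0 to h, and they agree for small
   t by [near0]. *)
pose f t := L (F (x0 + t *: h)) - psat c (t *: h).
have : f 1 = 0.
  pose eta := Num.min (r / `|h|) 1.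
  apply: (@identity_theorem R X f 1 eta) => //.
  - by rewrite lt_min divr_gt0 // ltr01.
  - move=> s s0 s1; apply: locpsB.
      apply: (locps_ray (B := B)) => //; apply: Fan.
      rewrite -ball_normE /= opprD addrA subrr add0r normrN normrZ ger0_norm //.
      by apply: le_lt_trans hg; rewrite ler_piMl.
    apply: (@locps_psat X X c gamma^-1 gamma s h _ gm0 h0 s0 _ mc gc); first exact: ltW.
    apply: le_lt_trans ghh; rewrite ler_wpM2l //; first exact: ltW.
    by rewrite ler_piMl.
  - move=> u u0; rewrite lt_min => /andP[u1 u2].
    rewrite /f near0 ?subrr // normrZ ger0_norm //; first by rewrite -ltr_pdivlMr.
    apply: le_lt_trans ghh; rewrite ler_wpM2l //; first exact: ltW.
    by rewrite ler_piMl // ltW.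
by rewrite /f scale1r => /eqP; rewrite subr_eq0 => /eqP.
Qed.

End NormalizedExpansion.

(** * The scalar majorant and its inexact Newton iteration *)

Section Majorant.
Context {R : realType}.
Variables g b a : R.
Hypotheses (g0 : 0 < g) (a0 : 0 < a) (bE : b = a ^+ 2 / g).
Let kappa := 1 - 2 * a - a ^+ 2.
Hypothesis k0 : 0 < kappa.
Let lam := b / (a + a ^+ 2).
Implicit Types t s e : R.

Definition dfmaj t := (1 - g * t) ^- 2 - 2.

(** The exact second-order Taylor remainder of f at t with increment s; up to the factor 1/g it is
    the bound of [sum_taylor_le] for p = g t and q = g s. *)
Definition efmaj t s := g * s ^+ 2 / ((1 - g * t) ^+ 2 * (1 - g * t - g * s)).

Lemma efmajE t s : g * t < 1 -> g * t + g * s < 1 ->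
  fmaj g b (t + s) = fmaj g b t + dfmaj t * s + efmaj t s.
Proof.
move=> t1 ts1; rewrite /fmaj /dfmaj /efmaj; field.
by rewrite !gt_eqF // ?mulrDr; lra.
Qed.

Lemma lam_pos : 0 < lam.
Proof. by rewrite divr_gt0 // ?bE ?divr_gt0 ?exprn_gt0 // addr_gt0 // exprn_gt0. Qed.

Lemma glam : g * lam = a / (1 + a).
Proof.
rewrite /lam bE; field.
by rewrite !gt_eqF // ?addr_gt0 // ?exprn_gt0 //; nra.
Qed.

Lemma one_sub_glam : 1 - g * lam = (1 + a)^-1.
Proof. by rewrite glam; field; rewrite gt_eqF // addr_gt0. Qed.

Lemma glam_lt1 : g * lam < 1.
Proof. by rewrite -subr_gt0 one_sub_glam invr_gt0 addr_gt0. Qed.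

Lemma lt1_of_le_lam t : t <= lam -> g * t < 1.
Proof. by move=> h; apply: le_lt_trans glam_lt1; rewrite ler_pM2l. Qed.

Lemma dfmaj_lam : dfmaj lam = - kappa.
Proof. by rewrite /dfmaj one_sub_glam exprVn invrK /kappa; ring. Qed.

Lemma fmaj_lam : fmaj g b lam = - (kappa * lam).
Proof.
have -> : fmaj g b lam = lam * (1 + a) - 2 * lam + b.
  by rewrite /fmaj one_sub_glam invrK.
have -> : b = lam * (a + a ^+ 2).
  by rewrite /lam divfK // gt_eqF // addr_gt0 // exprn_gt0.
by rewrite /kappa; ring.
Qed.

Lemma dfmaj_homo t s : t <= s -> g * s < 1 -> dfmaj t <= dfmaj s.
Proof.
move=> ts s1; rewrite lerD2r.
have ? : g * t <= g * s by rewrite ler_pM2l.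
rewrite lef_pV2 ?posrE ?exprn_gt0 ?subr_gt0 //; try lra.
by apply: lerXn2r; rewrite ?nnegrE; lra.
Qed.

Lemma dfmaj_ge t : 0 <= t -> g * t < 1 -> -1 <= dfmaj t.
Proof.
move=> t0 t1; have := dfmaj_homo t0 t1.
by rewrite {1}/dfmaj mulr0 subr0 expr1n invr1; lra.
Qed.

Lemma dfmaj_lt0 t : t <= lam -> dfmaj t <= - kappa.
Proof. by move=> h; rewrite -dfmaj_lam; apply: dfmaj_homo => //; exact: glam_lt1. Qed.

Lemma efmaj_ge0 t s : g * t + g * s < 1 -> 0 <= s -> 0 <= efmaj t s.
Proof.
move=> h s0; have gs : 0 <= g * s by rewrite mulr_ge0 // ltW.
rewrite divr_ge0 //; first by rewrite mulr_ge0 ?sqr_ge0 // ltW.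
by rewrite mulr_ge0 ?sqr_ge0 //; lra.
Qed.

Lemma efmaj_homo t t' s s' : t' <= t -> 0 <= s' -> s' <= s -> g * t + g * s < 1 ->
  efmaj t' s' <= efmaj t s.
Proof.
move=> tt s0 ss h.
have h1 : g * t' <= g * t by rewrite ler_pM2l.
have h2 : g * s' <= g * s by rewrite ler_pM2l.
have h3 : 0 <= g * s' by rewrite mulr_ge0 // ltW.
rewrite /efmaj; apply: ler_pM.
- by rewrite mulr_ge0 ?sqr_ge0 // ltW.
- by rewrite invr_ge0 mulr_ge0 ?sqr_ge0 //; lra.
- by rewrite ler_pM2l //; apply: lerXn2r; rewrite ?nnegrE //; lra.
rewrite lef_pV2 ?posrE ?mulr_gt0 ?exprn_gt0 //; try lra.
apply: ler_pM; rewrite ?sqr_ge0 //; try lra.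
by apply: lerXn2r; rewrite ?nnegrE; lra.
Qed.

(* The derivative of the majorant is convex, hence below its chord on [t, lam]. *)
Lemma efmaj_chord t s : 0 <= s -> t < lam -> t + s <= lam ->
  2 * (lam - t) * efmaj t s <= s ^+ 2 * (- dfmaj t - kappa).
Proof.
move=> s0 tl tsl.
have -> : - dfmaj t - kappa = dfmaj lam - dfmaj t by rewrite dfmaj_lam addrC.
have l1 := glam_lt1; rewrite /dfmaj /efmaj.
set p := 1 - g * t; set m := 1 - g * lam; set q := g * s.
have m0 : 0 < m by rewrite subr_gt0.
have pm : m < p by rewrite ltrD2l ltrN2 ltr_pM2l.
have p0 : 0 < p by apply: lt_trans pm.
have mq : m <= p - q by rewrite /m /p /q -addrA lerD2l -opprD lerN2 -mulrDr ler_pM2l.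
have q0 : 0 <= q by rewrite mulr_ge0 // ltW.
have -> : 2 * (lam - t) * (g * s ^+ 2 / (p ^+ 2 * (p - q))) =
    s ^+ 2 * ((p - m) * 2 / (p ^+ 2 * (p - q))).
  by rewrite /p /m; ring.
apply: ler_wpM2l; first exact: sqr_ge0.
(* Once the common factor p - m is removed, the claim is 2 m^2 <= (p + m)(p - q), which follows from
   m < p and m <= p - q. *)
have -> : m ^- 2 - 2 - (p ^- 2 - 2) = (p - m) * ((p + m) / (m ^+ 2 * p ^+ 2)).
  by field; rewrite !gt_eqF.
rewrite -mulrA; apply: ler_wpM2l; first by rewrite subr_ge0 ltW.
have pq : 0 < p - q by apply: lt_le_trans mq.
rewrite ler_pdivrMr ?mulr_gt0 ?exprn_gt0 //.
have -> : (p + m) / (m ^+ 2 * p ^+ 2) * (p ^+ 2 * (p - q)) = (p + m) * (p - q) / m ^+ 2.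
  by field; rewrite !gt_eqF.
rewrite ler_pdivlMr ?exprn_gt0 //.
by move: (ltW pm) mq m0; clear; nra.
Qed.

Lemma efmaj_lam t e : 0 <= e -> t + e <= lam ->
  efmaj t e <= e ^+ 2 * (g * (1 + a) ^+ 3).
Proof.
move=> e0 te; have l1 := glam_lt1.
have h1 : g * t + g * e <= g * lam by rewrite -mulrDr ler_pM2l.
have h2 : 0 <= g * e by rewrite mulr_ge0 // ltW.
have -> : (1 + a) ^+ 3 = ((1 - g * lam) ^+ 2 * (1 - g * lam))^-1.
  by rewrite one_sub_glam; field; rewrite gt_eqF // addr_gt0.
rewrite /efmaj [g * e ^+ 2]mulrC -mulrA ler_wpM2l ?sqr_ge0 // ler_pM2l //.
rewrite lef_pV2 ?posrE ?mulr_gt0 ?exprn_gt0 //; try lra.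
apply: ler_pM; rewrite ?sqr_ge0 //; try lra.
by apply: lerXn2r; rewrite ?nnegrE; lra.
Qed.

(** The tangent to f at t lies strictly below f at lambda, where f(lambda) = - kappa lambda; the
    allowance e <= kappa t uses up exactly the resulting slack. *)
Lemma fmaj_gap t e : t < lam -> e <= kappa * t ->
  fmaj g b t + e < (- dfmaj t - kappa) * (lam - t).
Proof.
move=> tl et; have l1 := glam_lt1.
have gt := lt1_of_le_lam (ltW tl).
have := @efmajE t (lam - t) gt; rewrite -mulrDr subrKC => /(_ l1).
rewrite fmaj_lam => E.
have : 0 < efmaj t (lam - t).
  rewrite divr_gt0 // ?mulr_gt0 ?exprn_gt0 ?subr_gt0 // mulrBr; lra.
by lra.
Qed.

Variable theta : R.
Hypotheses (th0 : 0 <= theta) (th1 : 2 * theta <= kappa * (1 + theta)).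

Definition next_t t e := t + (1 + theta) * (fmaj g b t + e) / - dfmaj t.
Definition next_e t e := e + 2 * theta * (fmaj g b t + e).

(** With u = -f'(t), [fmaj_gap] reduces t+ < lambda to (1 + theta)(u - kappa) <= u, which follows
    from u <= 1 and the bound on theta. *)
Lemma next_t_bounds t e : 0 <= t -> t < lam -> e <= kappa * t ->
  0 <= fmaj g b t + e -> t <= next_t t e /\ next_t t e < lam.
Proof.
move=> t0 tl et; rewrite /next_t; set h := _ + e => h0.
have hg := fmaj_gap tl et; rewrite -/h in hg.
have gt := lt1_of_le_lam (ltW tl).
have u1 := dfmaj_ge t0 gt; have u0 := dfmaj_lt0 (ltW tl).
move: hg u0 u1; set u := - dfmaj t => hg u0' u1'.
have u0 : kappa <= u by rewrite lerNr.
have u1 : u <= 1 by rewrite lerNl.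
have up : 0 < u by apply: lt_le_trans u0.
have up' := ltW up.
split; first by rewrite lerDl divr_ge0 // mulr_ge0 // addr_ge0.
rewrite -ltrBrDl ltr_pdivrMr //.
have lt0 : 0 < lam - t by rewrite subr_gt0.
have h2 : (1 + theta) * h < (1 + theta) * ((u - kappa) * (lam - t)).
  by rewrite ltr_pM2l // ltr_pwDl.
apply: lt_le_trans h2 _; rewrite mulrA [_ * u]mulrC ler_pM2r //.
have tu : theta * u <= theta by rewrite ler_piMr.
move: th0 th1 tu; lra.
Qed.

(** The increment 2 theta h of e is at most kappa (1 + theta) h, and this is at most kappa times the
    increment (1 + theta) h / u of t because u <= 1. *)
Lemma next_e_bounds t e : 0 <= t -> t < lam -> 0 <= e -> e <= kappa * t ->
  0 <= fmaj g b t + e -> 0 <= next_e t e /\ next_e t e <= kappa * next_t t e.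
Proof.
move=> t0 tl e0 et; rewrite /next_t /next_e; set h := _ + e => h0.
have gt := lt1_of_le_lam (ltW tl).
have u1 := dfmaj_ge t0 gt; have u0 := dfmaj_lt0 (ltW tl).
move: u0 u1; set u := - dfmaj t => u0' u1'.
have u0 : kappa <= u by rewrite lerNr.
have u1 : u <= 1 by rewrite lerNl.
have up : 0 < u by apply: lt_le_trans u0.
split; first by rewrite addr_ge0 // !mulr_ge0.
rewrite [kappa * _]mulrDr; apply: lerD => //.
rewrite mulrA ler_pdivlMr //.
apply: le_trans (_ : 2 * theta * h <= _); first by rewrite ler_piMr // !mulr_ge0.
by rewrite mulrA ler_wpM2r.
Qed.

(** The chord bound on the remainder E, [fmaj_gap] and (1 + theta)(u - kappa) <= (1 - theta) u give
    2 E <= (1 - theta)^2 h. The contraction factor is then theta + (1 - theta)^2 / 2 = (1 +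
    theta^2)/2. *)
Lemma next_residual t e : 0 <= t -> t < lam -> 0 <= e -> e <= kappa * t ->
  0 <= fmaj g b t + e ->
  fmaj g b (next_t t e) + next_e t e =
    theta * (fmaj g b t + e) + efmaj t (next_t t e - t) /\
  theta * (fmaj g b t + e) + efmaj t (next_t t e - t) <=
    (1 + theta ^+ 2) / 2 * (fmaj g b t + e).
Proof.
move=> t0 tl e0 et h0; have [n1 n2] := next_t_bounds t0 tl et h0.
have hg := fmaj_gap tl et.
have gt := lt1_of_le_lam (ltW tl); have gn := lt1_of_le_lam (ltW n2).
have u1 := dfmaj_ge t0 gt; have u0 := dfmaj_lt0 (ltW tl).
have sE : next_t t e - t = (1 + theta) * (fmaj g b t + e) / - dfmaj t.
  by rewrite /next_t addrAC subrr add0r.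
set s := next_t t e - t in sE *.
have s0 : 0 <= s by rewrite subr_ge0.
have nE : next_t t e = t + s by rewrite /s subrKC.
have gts : g * t + g * s < 1 by rewrite -mulrDr -nE.
have ch := @efmaj_chord t s s0 tl _; rewrite -nE in ch; have {}ch := ch (ltW n2).
have u00 : dfmaj t != 0.
  by rewrite lt_eqF // (le_lt_trans u0) // oppr_lt0.
have sd : dfmaj t * s = - ((1 + theta) * (fmaj g b t + e)).
  by rewrite sE; field; rewrite u00.
split; first by rewrite nE efmajE // /next_e; lra.
move: hg u0 u1 ch sd h0; set h := _ + e; set u := - dfmaj t.
have -> : dfmaj t = - u by rewrite opprK.
move: s0 tl; rewrite -subr_gt0; set d := lam - t; set E := efmaj t s.
move=> s0 d0 hg u0 u1 ch sd h0.
have su : s * u = (1 + theta) * h by lra.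
have up : 0 < u by apply: lt_le_trans k0 _; lra.
have step1 : (1 + theta) * (u - kappa) <= (1 - theta) * u.
  have tu : theta * u <= theta by rewrite ler_piMr //; lra.
  by move: th1 tu; lra.
(* with E <= s^2 (u - kappa) / (2 d), s = (1 + theta) h / u and h <= (u - kappa) d *)
have step2 : 2 * d * E * u ^+ 2 <= (1 - theta) ^+ 2 * h * u ^+ 2 * d.
  have uk : 0 <= u - kappa by lra.
  have h1 : 2 * d * E * u ^+ 2 <= (s * u) ^+ 2 * (u - kappa).
    have -> : (s * u) ^+ 2 * (u - kappa) = s ^+ 2 * (u - kappa) * u ^+ 2 by ring.
    by apply: ler_wpM2r => //; exact: sqr_ge0.
  apply: le_trans h1 _; rewrite su.
  have h2 : h * (u - kappa) <= (u - kappa) ^+ 2 * d.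
    by rewrite expr2 -mulrA mulrC ler_wpM2l // ltW.
  have h3 : ((1 + theta) * h) ^+ 2 * (u - kappa) <=
            (1 + theta) ^+ 2 * h * ((u - kappa) ^+ 2 * d).
    have -> : ((1 + theta) * h) ^+ 2 * (u - kappa) =
              (1 + theta) ^+ 2 * h * (h * (u - kappa)) by ring.
    by rewrite ler_wpM2l // mulr_ge0 // sqr_ge0.
  apply: le_trans h3 _.
  have -> : (1 + theta) ^+ 2 * h * ((u - kappa) ^+ 2 * d) =
      ((1 + theta) * (u - kappa)) ^+ 2 * (h * d) by ring.
  have -> : (1 - theta) ^+ 2 * h * u ^+ 2 * d = ((1 - theta) * u) ^+ 2 * (h * d) by ring.
  rewrite ler_wpM2r ?mulr_ge0 //; first exact: ltW.
  have p1 : 0 <= (1 + theta) * (u - kappa) by rewrite mulr_ge0 // addr_ge0.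
  by apply: lerXn2r => //; rewrite nnegrE //; lra.
have step3 : 2 * E <= (1 - theta) ^+ 2 * h.
  have du : 0 < d * u ^+ 2 by rewrite mulr_gt0 // exprn_gt0.
  rewrite -(ler_pM2r du); move: step2; congr (_ <= _); ring.
by move: step3; lra.
Qed.

End Majorant.

(** * Derivatives of the majorant *)

Section MajorantDerivatives.
Context {R : realType}.
Variables g b : R.

Lemma is_derive_fmaj t : 1 - g * t != 0 -> is_derive t 1 (fmaj g b) (dfmaj g t).
Proof.
move=> h; pose w := (cst 1 - g \*: id : R -> R).
have -> : fmaj g b = (id * (fun t => (w t)^-1) - 2 \*: id + cst b) by apply: funext.
have V : is_derive t 1 (fun t => (w t)^-1) (- (w t) ^- 2 *: (0 - g *: 1)).
  exact: is_deriveV.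
have H : is_derive t 1 (id * (fun t => (w t)^-1) - 2 \*: id + cst b : R -> R)
   ((t *: (- (w t) ^- 2 *: (0 - g *: 1)) + (w t)^-1 *: 1) - 2 *: 1 + 0).
  exact: is_derive_eq.
apply: (is_derive_eq H).
rewrite /dfmaj -[w t]/(1 - g * t) /GRing.scale /=.
by field; rewrite h.
Qed.

Lemma derive1_fmaj t : 1 - g * t != 0 -> derive1 (fmaj g b) t = dfmaj g t.
Proof. by move=> /is_derive_fmaj h; rewrite derive1E; exact: derive_val. Qed.

Lemma left_deriv_fmaj l : 0 < g -> 0 < 1 - g * l ->
  left_deriv (derive1 (fmaj g b)) l = 2 * g / (1 - g * l) ^+ 3.
Proof.
move=> g0 m0; apply: cvg_lim; first exact: Rhausdorff.
set m := 1 - g * l in m0 *.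
pose w t := 1 - g * t.
(* The factor t - l cancels from the difference quotient of f', leaving an expression continuous at
   l. *)
apply: (@cvg_trans _ ((fun t => g * (w t + m) * (m ^+ 2 * (w t * w t))^-1) @ l^'-)).
  apply: near_eq_cvg; near=> t.
  have tl : t < l by near: t; exact: nbhs_left_lt.
  have gtl : g * t < g * l by rewrite ltr_pM2l.
  have w0 : 0 < 1 - g * t by move: m0; rewrite /m; lra.
  rewrite !derive1_fmaj ?gt_eqF // /dfmaj /w /m.
  have tl0 : t - l != 0 by rewrite lt_eqF // subr_lt0.
  have m1 : 0 < 1 - g * l := m0.
  by field; rewrite tl0 !gt_eqF.
apply: cvg_at_left_filter.
have cw : w t @[t --> l] --> m.
  by apply: cvgB; [exact: cvg_cst | apply: cvgMr; exact: cvg_id].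
have -> : 2 * g / m ^+ 3 = g * (m + m) * (m ^+ 2 * (m * m))^-1.
  by field; rewrite gt_eqF.
apply: cvgM.
  by apply: cvgMr; apply: cvgD => //; exact: cvg_cst.
apply: cvgV; first by rewrite !mulf_neq0 ?expf_neq0 // gt_eqF.
by apply: cvgMr; exact: cvgM.
Unshelve. all: by end_near.
Qed.

End MajorantDerivatives.

(** * Zeros of the majorant *)

Section MajorantRoots.
Context {R : realType}.
Variables g b : R.
Hypotheses (g0 : 0 < g) (b0 : 0 < b).
Hypothesis gb : g * b < 3 - 2 * Num.sqrt 2.
Let a := Num.sqrt (g * b).
Let D := 1 - 6 * g * b + (g * b) ^+ 2.
Let tstar := (1 + g * b - Num.sqrt D) / (4 * g).
Let taubar := (1 + g * b + Num.sqrt D) / (4 * g).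
Let lam := b / (a + g * b).

Lemma sqrt_gb_pos : 0 < a.
Proof. by rewrite sqrtr_gt0 mulr_gt0. Qed.

Lemma sqr_sqrt_gb : a ^+ 2 = g * b.
Proof. by rewrite sqr_sqrtr // ltW // mulr_gt0. Qed.

(** Since 3 - 2 sqrt 2 = (sqrt 2 - 1)^2, the hypothesis says a < sqrt 2 - 1, the positive root of 1
    - 2a - a^2. *)
Lemma kappa_pos : 0 < 1 - 2 * a - g * b.
Proof.
have s2 : Num.sqrt 2 ^+ 2 = 2 :> R by rewrite sqr_sqrtr.
have s0 : 0 <= Num.sqrt 2 :> R by exact: sqrtr_ge0.
have s1 : 1 < Num.sqrt 2 :> R by rewrite -[X in X < _]sqrtr1 ltr_sqrt // ltr1n.
have a0 := sqrt_gb_pos; have a2 := sqr_sqrt_gb.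
have : a < Num.sqrt 2 - 1.
  rewrite -(ltr_pXn2r (n := 2)) ?nnegrE ?ltW // ?subr_gt0 // a2.
  by apply: lt_le_trans gb _; rewrite sqrrB s2; lra.
rewrite -a2; move: a0 s2 s1; nra.
Qed.

Lemma gb_lt1 : g * b < 1.
Proof. by have := kappa_pos; have := sqrt_gb_pos; lra. Qed.

(** As (1 - g b)^2 - (2a)^2, the discriminant is a product with kappa as one factor. *)
Lemma discr_ge0 : 0 <= D.
Proof.
have -> : D = (1 - 2 * a - g * b) * (1 + 2 * a - g * b).
  transitivity ((1 - g * b) ^+ 2 - 4 * a ^+ 2); last by ring.
  by rewrite sqr_sqrt_gb /D; ring.
rewrite mulr_ge0 //; first exact/ltW/kappa_pos.
by have := gb_lt1; have := sqrt_gb_pos; lra.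
Qed.

Lemma sqrt_discr_lt : Num.sqrt D < 1 - g * b.
Proof.
have h : 0 < 1 - g * b by rewrite subr_gt0 gb_lt1.
rewrite -[X in _ < X]gtr0_norm // -sqrtr_sqr ltr_sqrt ?exprn_gt0 //.
have gb0 : 0 < g * b by rewrite mulr_gt0.
by rewrite /D; lra.
Qed.

(** The numerator of f is 2 g t^2 - (1 + g b) t + b, with roots [tstar] and [taubar]. *)
Lemma fmaj_factor t : g * t < 1 ->
  fmaj g b t = 2 * g * (t - tstar) * (t - taubar) / (1 - g * t).
Proof.
move=> t1; have h : 1 - g * t != 0 by rewrite gt_eqF // subr_gt0.
have sD : Num.sqrt D ^+ 2 = D by rewrite sqr_sqrtr // discr_ge0.
have -> : 2 * g * (t - tstar) * (t - taubar) = 2 * g * t ^+ 2 - (1 + g * b) * t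
    + ((1 + g * b) ^+ 2 - Num.sqrt D ^+ 2) / (8 * g).
  by rewrite /tstar /taubar; field; rewrite gt_eqF.
by rewrite sD /D /fmaj; field; rewrite h gt_eqF.
Qed.

Lemma tstar_le_taubar : tstar <= taubar.
Proof.
rewrite ler_pM2r ?invr_gt0 ?mulr_gt0 // lerD2l.
by have := sqrtr_ge0 D; lra.
Qed.

Lemma gtaubar_lt1 : g * taubar < 1.
Proof.
have -> : g * taubar = (1 + g * b + Num.sqrt D) / 4.
  by rewrite /taubar; field; rewrite gt_eqF.
by have := sqrt_discr_lt; lra.
Qed.

Lemma le_tstar t : t < taubar -> 0 <= fmaj g b t -> t <= tstar.
Proof.
move=> tt; have gt : g * t < 1.
  by apply: le_lt_trans gtaubar_lt1; rewrite ler_pM2l // ltW.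
rewrite fmaj_factor // pmulr_lge0 ?invr_gt0 ?subr_gt0 //.
rewrite nmulr_lge0 ?subr_lt0 // -mulrA pmulr_rle0 //.
by rewrite pmulr_rle0 // subr_le0.
Qed.

Lemma fmaj_lt0_between t : g * t < 1 -> fmaj g b t < 0 -> tstar < t < taubar.
Proof.
move=> gt; rewrite fmaj_factor // pmulr_llt0 ?invr_gt0 ?subr_gt0 // -mulrA pmulr_rlt0.
  move=> h; have := tstar_le_taubar; case: (ltP tstar t) => h1 h2 /=.
    rewrite -subr_gt0 in h1; move: h; rewrite pmulr_rlt0 //.
    by rewrite subr_lt0.
  exfalso; move: h; apply/negP; rewrite -leNgt.
  by rewrite mulr_le0 // subr_le0 // (le_trans h1).
by rewrite mulr_gt0.
Qed.

(** The value f(lambda) = - kappa lambda is negative, which on g t < 1 happens only between the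
    zeros. *)
Lemma tstar_lt_lam : tstar < lam < taubar.
Proof.
have a0 := sqrt_gb_pos; have a2 := sqr_sqrt_gb.
have bE : b = a ^+ 2 / g by rewrite a2 mulrAC mulfV ?mul1r // gt_eqF.
have k0 : 0 < 1 - 2 * a - a ^+ 2 by rewrite a2 kappa_pos.
rewrite /lam -a2; apply: fmaj_lt0_between; first exact: glam_lt1.
by rewrite fmaj_lam // oppr_lt0 mulr_gt0 // (lam_pos g0 a0 bE).
Qed.

End MajorantRoots.

(** * The inexact Newton method for the normalized map G *)

Section NormalizedNewton.
Context {R : realType} {X : completeNormedModType R}.
Variables (G : X -> X) (x0 : X) (c : seq X -> X) (g b a : R).
Hypotheses (g0 : 0 < g) (a0 : 0 < a) (bE : b = a ^+ 2 / g).
Let kappa := 1 - 2 * a - a ^+ 2.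
Hypothesis k0 : 0 < kappa.
Let lam := b / (a + a ^+ 2).
Hypotheses (mc : mlin c) (gc : geo c g^-1 g) (c1 : forall h, c [:: h] = h).
Hypothesis (Gb : `|G x0| <= b).
Hypothesis (GE : forall h, `|h| < g^-1 -> G (x0 + h) = psat c h).
Implicit Types (x y u : X) (t s e : R).

(** The derivative of G at x in the direction u, as the termwise derivative of the series centred at
    [x0]. *)
Definition dps x u : X := psat (del u c) (x - x0).

Let gi0 : 0 <= g^-1. Proof. by rewrite invr_ge0 ltW. Qed.
Let g0' : 0 <= g. Proof. exact: ltW. Qed.

Lemma psat_sub x : g * `|x - x0| < 1 -> G x = psat c (x - x0).
Proof.
by move=> h; rewrite -[in LHS](subrKC x0 x) GE // -[_^-1]mulr1 ltr_pdivlMl.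
Qed.

Lemma dps_lin x k u v : g * `|x - x0| < 1 ->
  dps x (k *: u + v) = k *: dps x u + dps x v.
Proof. by move=> h; apply: (psat_del_lin (K := g^-1) (g := g)). Qed.

Lemma dpsB x u v : g * `|x - x0| < 1 -> dps x (u - v) = dps x u - dps x v.
Proof.
move=> h; rewrite addrC -scaleN1r dps_lin // scaleN1r addrC //.
Qed.

Lemma dps_near_id x t u : `|x - x0| <= t -> g * t < 1 ->
  `|dps x u - u| <= (dfmaj g t + 1) * `|u|.
Proof.
move=> xt gt; have gx : g * `|x - x0| < 1 by apply: le_lt_trans gt; rewrite ler_pM2l.
rewrite -[X in _ - X]c1; apply: le_trans (psat_del_le u gi0 g0' gc gx) _.
rewrite mulKf ?gt_eqF // mulrC ler_wpM2r //.
by have := dfmaj_homo g0 xt gt; rewrite /dfmaj; lra.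
Qed.

(** Stands for |G'(x)^-1| <= 1/|f'(t)| when f'(t) < 0, in a form that presupposes no inverse. *)
Lemma dps_ge x t u : `|x - x0| <= t -> g * t < 1 -> - dfmaj g t * `|u| <= `|dps x u|.
Proof.
move=> xt gt; have h := dps_near_id u xt gt.
have : `|u| <= `|dps x u| + `|dps x u - u|.
  by rewrite -[X in `|X| <= _](subKr (dps x u)); exact: ler_normB.
by lra.
Qed.

Lemma dps_le x t u : `|x - x0| <= t -> g * t < 1 ->
  `|dps x u| <= (dfmaj g t + 2) * `|u|.
Proof.
move=> xt gt; have h := dps_near_id u xt gt.
have : `|dps x u| <= `|dps x u - u| + `|u|.
  by rewrite -[X in `|X| <= _](subrK u); exact: ler_normD.
by lra.
Qed.

Lemma G_taylor x t u s : `|x - x0| <= t -> `|u| <= s -> g * t + g * s < 1 ->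
  `|G (x + u) - G x - dps x u| <= efmaj g t s.
Proof.
move=> xt us gts; have t0 : 0 <= t by apply: le_trans xt.
have gx : g * `|x - x0| <= g * t by rewrite ler_pM2l.
have gu : g * `|u| <= g * s by rewrite ler_pM2l.
have gu0 : 0 <= g * `|u| by rewrite mulr_ge0.
have gxu : g * `|x - x0| + g * `|u| < 1 by lra.
have e1 : x + u - x0 = x - x0 + u by rewrite addrAC.
have gxu' : g * `|x + u - x0| < 1.
  by apply: le_lt_trans gxu; rewrite -mulrDr ler_pM2l // e1 ler_normD.
rewrite !psat_sub //; last by lra.
rewrite e1; apply: le_trans (psat_taylor_le gi0 g0' mc gc gxu) _.
apply: (le_trans _ (efmaj_homo g0 xt (normr_ge0 u) us gts)).
have -> : efmaj g `|x - x0| `|u| = g^-1 * ((g * `|u|) ^+ 2 /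
    ((1 - g * `|x - x0|) ^+ 2 * (1 - g * `|x - x0| - g * `|u|))) => //.
by rewrite /efmaj; field; rewrite !gt_eqF //; lra.
Qed.

(** Only degrees 2 and above contribute to G - id up to a constant, and their increments sum to the
    factor f'(t) + 1. Where f'(t) < 0 this makes G injective. *)
Lemma G_lip x y t : `|x - x0| <= t -> `|y - x0| <= t -> g * t < 1 ->
  `|G y - G x - (y - x)| <= (dfmaj g t + 1) * `|y - x|.
Proof.
move=> xt yt gt.
have gx : g * `|x - x0| < 1 by apply: le_lt_trans gt; rewrite ler_pM2l.
have gy : g * `|y - x0| < 1 by apply: le_lt_trans gt; rewrite ler_pM2l.
have e1 : y - x = y - x0 - (x - x0) by rewrite opprB addrA subrK.
rewrite !psat_sub // e1 -[X in _ - _ - X]c1.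
apply: le_trans (psat_lip_le gi0 g0' mc gc xt yt gt) _.
rewrite mulKf ?gt_eqF // mulrC ler_wpM2r // /dfmaj; lra.
Qed.

(** The linear part of G at [x0] is the identity, so a zero at distance s satisfies s <= b +
    [efmaj g 0 s], while f(s) = b - s + [efmaj g 0 s]. *)
Lemma fmaj_ge0_of_zero y : g * `|y - x0| < 1 -> G y = 0 -> 0 <= fmaj g b `|y - x0|.
Proof.
move=> gy Gy; set s := `|y - x0|.
have n0 : `|x0 - x0| <= 0 by rewrite subrr normr0.
have g00 : g * 0 + g * s < 1 by rewrite mulr0 add0r.
have := G_taylor n0 (lexx s) g00; rewrite subrKC Gy sub0r.
have -> : dps x0 (y - x0) = y - x0.
  apply/eqP; rewrite -subr_eq0 -normr_le0.
  have := dps_near_id (y - x0) n0; rewrite mulr0 ltr01 => /(_ isT) /le_trans; apply.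
  by rewrite /dfmaj mulr0 subr0 expr1n invr1 (_ : 1 - 2 + 1 = 0) ?mul0r //; ring.
have := @efmajE R g b 0 s; rewrite mulr0 !add0r => /(_ ltr01 gy) ->.
rewrite /fmaj /dfmaj mulr0 subr0 expr1n invr1 mul0r mulr0 subr0 add0r.
rewrite -opprD normrN => h.
have : s <= `|G x0 + (y - x0)| + `|G x0|.
  by rewrite /s -{1}[y - x0](addKr (G x0)) addrC; exact: ler_normB.
by move: Gb; lra.
Qed.

Variable theta : R.
Hypotheses (th0 : 0 <= theta) (th1 : 2 * theta <= kappa * (1 + theta)).

Definition majseq k := iter k
  (fun p => (next_t g b theta p.1 p.2, next_e g b theta p.1 p.2)) (0 : R, 0 : R).
Let t_ k := (majseq k).1.
Let e_ k := (majseq k).2.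

Let b0 : 0 < b. Proof. by rewrite bE divr_gt0 // exprn_gt0. Qed.

Lemma majseq_inv k : [/\ 0 <= t_ k, t_ k < lam, 0 <= e_ k, e_ k <= kappa * t_ k &
  0 <= fmaj g b (t_ k) + e_ k].
Proof.
elim: k => [|k [H1 H2 H3 H4 H5]].
  rewrite /t_ /e_ /=; split => //; first exact: (lam_pos g0 a0 bE).
  - by rewrite mulr0.
  - by rewrite /fmaj mul0r mulr0 subr0 addr0 add0r ltW.
have [A1 A2] := next_t_bounds g0 a0 bE k0 th0 th1 H1 H2 H4 H5.
have [A3 A4] := next_e_bounds g0 a0 bE k0 th0 th1 H1 H2 H3 H4 H5.
have [A5 _] := next_residual g0 a0 bE k0 th0 th1 H1 H2 H3 H4 H5.
rewrite /t_ /e_ /majseq iterS -/(majseq k); split => //.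
  exact: le_trans A1.
suff : 0 <= fmaj g b (next_t g b theta (t_ k) (e_ k)) + next_e g b theta (t_ k) (e_ k).
  by [].
rewrite A5; apply: addr_ge0; first by rewrite mulr_ge0.
apply: (efmaj_ge0 g0); last by rewrite subr_ge0.
by rewrite -mulrDr subrKC; exact: (lt1_of_le_lam g0 a0 bE (ltW A2)).
Qed.

Lemma majseq_residual k :
  fmaj g b (t_ k) + e_ k <= ((1 + theta ^+ 2) / 2) ^+ k * b.
Proof.
elim: k => [|k IH].
  by rewrite /t_ /e_ /fmaj /= mul0r mulr0 subr0 addr0 add0r mul1r.
have [H1 H2 H3 H4 H5] := majseq_inv k.
have [A5 A6] := next_residual g0 a0 bE k0 th0 th1 H1 H2 H3 H4 H5.
rewrite [X in X <= _]A5; apply: le_trans A6 _.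
have -> : forall q : R, q ^+ k.+1 * b = q * (q ^+ k * b) by move=> q; rewrite exprS mulrA.
apply: ler_wpM2l => //.
by rewrite divr_ge0 // addr_ge0 // sqr_ge0.
Qed.

(** The residual condition bounds G'(x) u by (1 + theta)|G(x)|, and [dps_ge] turns this into a bound
    on u. The new value of G is the residual plus the Taylor error, the splitting found in
    [next_residual]. *)
Lemma newton_step_le x u t e :
  0 <= t -> t < lam -> 0 <= e -> e <= kappa * t -> `|x - x0| <= t ->
  `|G x| <= fmaj g b t + e -> `|G x + dps x u| <= theta * `|G x| ->
  `|u| <= next_t g b theta t e - t /\
  `|G (x + u)| <= fmaj g b (next_t g b theta t e) + next_e g b theta t e.
Proof.
move=> t0 tl e0 et xt Gx res.
have h0 : 0 <= fmaj g b t + e by apply: le_trans Gx.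
have [A1 A2] := next_t_bounds g0 a0 bE k0 th0 th1 t0 tl et h0.
have [A5 _] := next_residual g0 a0 bE k0 th0 th1 t0 tl e0 et h0.
have gt := lt1_of_le_lam g0 a0 bE (ltW tl).
have d0 : 0 < - dfmaj g t.
  by rewrite oppr_gt0 (le_lt_trans (dfmaj_lt0 g0 a0 bE (ltW tl))) // oppr_lt0.
have us : `|u| <= next_t g b theta t e - t.
  rewrite /next_t addrAC subrr add0r ler_pdivlMr // mulrC.
  apply: le_trans (dps_ge u xt gt) _.
  rewrite -[X in `|X| <= _](addKr (G x)) addrC.
  apply: le_trans (ler_normB _ _) _; apply: le_trans (lerD res (lexx _)) _.
  by rewrite mulrDl mul1r addrC lerD // ler_wpM2l.
split=> //; rewrite A5.
have gts : g * t + g * (next_t g b theta t e - t) < 1.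
  by rewrite -mulrDr subrKC; exact: (lt1_of_le_lam g0 a0 bE (ltW A2)).
have E := G_taylor xt us gts.
have h1 : `|G (x + u)| <= `|G x + dps x u| + `|G (x + u) - G x - dps x u|.
  by apply: le_trans (ler_normD _ _); rewrite [X in _ <= `|X|]addrC addrACA subrK addNr addr0.
apply: le_trans h1 _.
apply: lerD; last exact: E.
by apply: le_trans res _; rewrite ler_wpM2l.
Qed.

(** Only the steps before k are assumed, so the bound also holds for a finite initial segment of the
    method; its well-definedness rests on this. *)
Lemma newton_invariant (x : nat -> X) k : x 0%N = x0 ->
  (forall j, (j < k)%N ->
    `|G (x j) + dps (x j) (x j.+1 - x j)| <= theta * `|G (x j)|) ->
  `|x k - x0| <= t_ k /\ `|G (x k)| <= fmaj g b (t_ k) + e_ k.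
Proof.
move=> xE; elim: k => [|k IH] H.
  rewrite /t_ /e_ /= xE subrr normr0; split=> //.
  by rewrite /fmaj mul0r mulr0 subr0 addr0 add0r.
have [I1 I2] := IH (fun j jk => H j (leqW jk)).
have [H1 H2 H3 H4 H5] := majseq_inv k.
have [A1 A2] := newton_step_le H1 H2 H3 H4 I1 I2 (H k (ltnSn k)).
rewrite subrKC in A2; split; last exact: A2.
have -> : x k.+1 - x0 = (x k.+1 - x k) + (x k - x0) by rewrite addrA subrK.
by apply: le_trans (ler_normD _ _) _; move: A1 I1; rewrite /t_ /=; lra.
Qed.

Section Sequence.
Variable x : nat -> X.
Hypotheses (xE : x 0%N = x0) (xN : forall k,
  `|G (x k) + dps (x k) (x k.+1 - x k)| <= theta * `|G (x k)|).

Let inv k : `|x k - x0| <= t_ k /\ `|G (x k)| <= fmaj g b (t_ k) + e_ k.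
Proof. by apply: newton_invariant => // j _; exact: xN. Qed.

Lemma newton_ball k : `|x k - x0| < lam.
Proof. by apply: le_lt_trans (inv k).1 _; have [] := majseq_inv k. Qed.

Lemma newton_residual k : `|G (x k)| <= ((1 + theta ^+ 2) / 2) ^+ k * b.
Proof. by apply: le_trans (inv k).2 _; exact: majseq_residual. Qed.

Lemma newton_step k : `|x k.+1 - x k| <= t_ k.+1 - t_ k.
Proof.
have [H1 H2 H3 H4 H5] := majseq_inv k; have [I1 I2] := inv k.
by have [] := newton_step_le H1 H2 H3 H4 I1 I2 (xN k).
Qed.

Lemma newton_dist k n : `|x (n + k)%N - x k| <= t_ (n + k)%N - t_ k.
Proof.
elim: n => [|n IH]; first by rewrite !subrr normr0.
have -> : x (n.+1 + k)%N - x k = (x (n + k).+1 - x (n + k)%N) + (x (n + k)%N - x k).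
  by rewrite addrA subrK.
apply: le_trans (ler_normD _ _) _.
have := newton_step (n + k); rewrite addSn; move: IH; lra.
Qed.

Lemma newton_cvg : exists xs : X, x @ \oo --> xs.
Proof.
have [||cu _] := @series_dominated R X (fun k => x k.+1 - x k)
  (fun k => t_ k.+1 - t_ k) lam.
- exact: newton_step.
- move=> N; rewrite -(big_mkord xpredT (fun k => t_ k.+1 - t_ k)) telescope_sumr //.
  by have [_ h _ _ _] := majseq_inv N; rewrite /t_ /= subr0 ltW.
exists (limn (series (fun k => x k.+1 - x k)) + x0).
have cl : (fun N => series (fun k => x k.+1 - x k) N + x0) @ \oo -->
    limn (series (fun k => x k.+1 - x k)) + x0.
  by apply: cvgD => //; exact: cvg_cst.
have e : (fun N => series (fun k => x k.+1 - x k) N + x0) = x.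
  by apply: funext => N; rewrite /series /= telescope_sumr // xE subrK.
by rewrite e in cl.
Qed.

Variable xs : X.
Hypothesis xs_lim : x @ \oo --> xs.

Lemma newton_lim_dist k : `|xs - x k| <= lam - t_ k.
Proof.
have h := xs_lim; rewrite -(cvg_shiftn k) in h.
apply: (lim_norm_le (cvgB h (cvg_cst (x k)))) => n /=.
apply: le_trans (newton_dist k n) _; rewrite lerD2r ltW //.
by have [] := majseq_inv (n + k).
Qed.

Lemma newton_lim_ball : `|xs - x0| <= lam.
Proof. by have := newton_lim_dist 0; rewrite xE /t_ /= subr0. Qed.

Lemma newton_lim_zero : G xs = 0.
Proof.
have q0 : 0 <= (1 + theta ^+ 2) / 2 by rewrite divr_ge0 // addr_ge0 // sqr_ge0.
have k1 : kappa < 1 by rewrite /kappa -addrA gtrDl -opprD oppr_lt0 addr_gt0 ?mulr_gt0 ?exprn_gt0.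
have tl1 : theta < 1.
  have : kappa * (1 + theta) < 1 * (1 + theta) by rewrite ltr_pM2r // ltr_pwDl.
  by move=> /(le_lt_trans th1); lra.
have q1 : (1 + theta ^+ 2) / 2 < 1.
  by have : theta ^+ 2 < 1 by [rewrite expr_lt1]; lra.
apply/eqP; rewrite -normr_le0.
(* The factor 2 is a crude form of 2 - kappa, a Lipschitz constant of G on the closed ball of radius
   lambda. *)
have bound k : `|G xs| <= ((1 + theta ^+ 2) / 2) ^+ k * b + 2 * `|x k - xs|.
  have := G_lip newton_lim_ball (ltW (newton_ball k)) (glam_lt1 g0 a0 bE).
  rewrite (dfmaj_lam g0 a0 bE) -/kappa => h.
  have : `|G xs| <= `|G (x k)| + `|G (x k) - G xs|.
    by rewrite -[X in `|X| <= _](subKr (G (x k))); exact: ler_normB.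
  have : `|G (x k) - G xs| <= `|G (x k) - G xs - (x k - xs)| + `|x k - xs|.
    by rewrite -[X in `|X| <= _](subrK (x k - xs)); exact: ler_normD.
  have := newton_residual k.
  have : (- kappa + 1) * `|x k - xs| <= 1 * `|x k - xs|.
    by rewrite ler_wpM2r // gerDr oppr_le0 ltW.
  by move: h; lra.
have cv : ((1 + theta ^+ 2) / 2) ^+ k * b + 2 * `|x k - xs| @[k --> \oo] --> 0 * b + 2 * 0.
  apply: cvgD; first by apply: cvgMl; apply: cvg_expr; rewrite ger0_norm.
  apply: cvgMr; apply/norm_cvg0P.
  by rewrite -(subrr xs); apply: cvgB => //; exact: cvg_cst.
rewrite mul0r mulr0 addr0 in cv.
apply: (cvgr_to_ge cv).
by apply: nearW => k; exact: bound.
Qed.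

(** The vector G'(x_k)(xs - x_{k+1}) is the Taylor error between x_k and xs minus the residual of
    the step. The residual is at most theta |G(x_k)|, and since G(xs) = 0 the same Taylor expansion
    bounds |G(x_k)|. *)
Lemma newton_error k : - dfmaj g (t_ k) * `|xs - x k.+1| <=
  (1 + theta) * efmaj g (t_ k) `|xs - x k|
  + theta * ((dfmaj g (t_ k) + 2) * `|xs - x k|).
Proof.
set e := `|xs - x k|; have [H1 H2 H3 H4 H5] := majseq_inv k; have [I1 I2] := inv k.
have gt := lt1_of_le_lam g0 a0 bE (ltW H2).
have gx : g * `|x k - x0| < 1 by apply: le_lt_trans gt; rewrite ler_pM2l.
have gte : g * t_ k + g * e < 1.
  rewrite -mulrDr; apply: (lt1_of_le_lam g0 a0 bE).
  by have := newton_lim_dist k; rewrite -/e -/lam; lra.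
have := G_taylor I1 (lexx e) gte; rewrite subrKC newton_lim_zero sub0r => hE.
apply: le_trans (dps_ge (xs - x k.+1) I1 gt) _.
have e1 : xs - x k.+1 = (xs - x k) - (x k.+1 - x k) by rewrite opprB addrA subrK.
have e2 : dps (x k) (xs - x k.+1) = - (- G (x k) - dps (x k) (xs - x k))
    - (G (x k) + dps (x k) (x k.+1 - x k)).
  by rewrite e1 dpsB // !opprD !opprK addrACA subrr add0r.
rewrite e2; apply: le_trans (ler_normB _ _) _; rewrite normrN.
have hG : `|G (x k)| <= (dfmaj g (t_ k) + 2) * e + efmaj g (t_ k) e.
  have := dps_le (xs - x k) I1 gt; rewrite -/e => h.
  have : `|G (x k)| <= `|- G (x k) - dps (x k) (xs - x k)| + `|dps (x k) (xs - x k)|.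
    by rewrite -normrN -{1}[- G _](subrK (dps (x k) (xs - x k))); exact: ler_normD.
  by lra.
have := ler_wpM2l th0 hG; have := xN k; lra.
Qed.

(** Everything is moved from t_k to lambda: [efmaj_lam] for the remainder and -f'(t_k) >= kappa for
    the slope. The constant 2 g (1 + a)^3 is the second derivative of f at lambda. *)
Lemma newton_quadratic k : `|xs - x k.+1| <=
  ((1 + theta) / 2 * (2 * g * (1 + a) ^+ 3 / kappa) * `|xs - x k|
     + theta * ((2 - kappa) / kappa)) * `|xs - x k|.
Proof.
have [H1 H2 H3 H4 H5] := majseq_inv k.
have := newton_error k; set e := `|xs - x k| => /= h.
have el := newton_lim_dist k; rewrite -/e in el.
have e0 : 0 <= e by exact: normr_ge0.
have u0 := dfmaj_lt0 g0 a0 bE (ltW H2); rewrite -/kappa in u0.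
have ek : efmaj g (t_ k) e <= e ^+ 2 * (g * (1 + a) ^+ 3).
  by apply: (efmaj_lam g0 a0 bE) => //; rewrite -/lam; lra.
have -> : ((1 + theta) / 2 * (2 * g * (1 + a) ^+ 3 / kappa) * e
     + theta * ((2 - kappa) / kappa)) * e =
  ((1 + theta) * (e ^+ 2 * (g * (1 + a) ^+ 3)) + theta * ((2 - kappa) * e)) / kappa.
  by field; rewrite gt_eqF.
rewrite ler_pdivlMr // mulrC.
have t1 : 0 <= 1 + theta by rewrite addr_ge0.
apply: (@le_trans _ _ (- dfmaj g (t_ k) * `|xs - x k.+1|)).
  by rewrite ler_wpM2r // lerNr.
apply: le_trans h _; apply: lerD; first by rewrite ler_wpM2l.
rewrite ler_wpM2l // ler_wpM2r //; lra.
Qed.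

Lemma newton_linear k : `|xs - x k.+1| <=
  ((1 + theta) / 2 + 2 * theta / kappa) * `|xs - x k|.
Proof.
have [H1 H2 H3 H4 H5] := majseq_inv k.
have := newton_error k; set e := `|xs - x k| => /=.
have el := newton_lim_dist k; rewrite -/e in el.
have e0 : 0 <= e by exact: normr_ge0.
have u0 := dfmaj_lt0 g0 a0 bE (ltW H2); rewrite -/kappa in u0.
have tel : t_ k + e <= lam by move: el; lra.
have := efmaj_chord g0 a0 bE e0 H2 tel; rewrite -/kappa -/lam.
set u := - dfmaj g (t_ k); set E := efmaj _ _ _.
have -> : dfmaj g (t_ k) + 2 = 2 - u by rewrite /u opprK addrC.
have ku : kappa <= u by rewrite lerNr.
have d0 : 0 < lam - t_ k by rewrite subr_gt0.
move=> ch h.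
have up : 0 < u by apply: lt_le_trans ku.
(* The distance e is at most lambda - t_k, so one factor e in the chord bound cancels against it. *)
have E2 : 2 * E <= e * (u - kappa).
  rewrite -(ler_pM2l d0) mulrA [_ * 2]mulrC; apply: le_trans ch _.
  rewrite expr2 -mulrA [X in _ <= X]mulrC -mulrA ler_wpM2l //.
  by rewrite [e * _]mulrC ler_wpM2l // subr_ge0.
have t1 : 0 <= 1 + theta by rewrite addr_ge0.
rewrite -(ler_pM2l up); apply: le_trans h _.
have E3 := ler_wpM2l t1 E2.
have E4 : theta * e * 2 <= u * (2 * theta / kappa * e).
  have -> : u * (2 * theta / kappa * e) = theta * e * 2 * (u / kappa).
    by field; rewrite gt_eqF.
  by rewrite ler_peMr ?mulr_ge0 // ler_pdivlMr // mul1r.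
have E5 : 0 <= theta * e * u by rewrite !mulr_ge0 // ltW.
have E6 : 0 <= (1 + theta) * (e * kappa) by rewrite !mulr_ge0 // ltW.
by move: E3 E4 E5 E6; lra.
Qed.

End Sequence.

Lemma zero_unique y z t : dfmaj g t < 0 -> g * t < 1 -> `|y - x0| <= t ->
  `|z - x0| <= t -> G y = 0 -> G z = 0 -> y = z.
Proof.
move=> dt gt yt zt Gy Gz.
have := G_lip zt yt gt; rewrite Gy Gz subrr sub0r normrN => h.
apply/eqP; rewrite -subr_eq0 -normr_le0.
have : - dfmaj g t * `|y - z| <= 0 by lra.
by rewrite pmulr_rle0 // oppr_gt0.
Qed.

End NormalizedNewton.

(** * Transfer to F and proof of the theorem *)

(** Identifies F'(x0)^-1 F'(x) with the termwise derivative, so that a step for F is a step for the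
    normalized series. *)
Lemma expands_lin_comp (R : realType) (X Y : completeNormedModType R) (F : X -> Y)
    (L : {linear Y -> X}) (x0 x : X) (c : seq X -> X) (g : R) u :
  0 < g -> mlin c -> geo c g^-1 g ->
  (forall h, `|h| < g^-1 -> L (F (x0 + h)) = psat c h) ->
  continuous L -> differentiable F x -> `|x - x0| < g^-1 ->
  differentiable (L \o F) x /\ L ('d F x u) = dps x0 c x u /\ 'd (L \o F) x u = dps x0 c x u.
Proof.
move=> g0 mc gc Lc Lcont dF xg.
have E : expands (L \o F) x0 c g^-1 g g^-1.
  by do 2?split; rewrite ?invr_ge0 ?invr_gt0 ?mulVf ?gt_eqF // ltW.
have [dG dE] := expands_diff E xg; rewrite subrKC in dG dE.
split=> //; split; last exact: dE.
have := dE u; rewrite diff_comp //; last exact: linear_differentiable.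
by rewrite /= diff_lin.
Qed.

Unset Implicit Arguments.

Theorem theorem6p1 (R : realType) (X Y : completeNormedModType R)
  (C : set X) (F : X -> Y) (x0 : X) (Linv : Y -> X) (b theta : R) :
  {within C, continuous F} ->
  analytic_on F (interior C) ->
  interior C x0 ->
  (* F'(x0) is non-singular, with inverse Linv *)
  (forall h, Linv ('d F x0 h) = h) -> (forall y, 'd F x0 (Linv y) = y) ->
  let gamma := gamma_of Linv F x0 in
  0 < gamma ->
  ball x0 gamma^-1 `<=` C ->
  0 < b ->
  `|Linv (F x0)| <= b ->
  gamma * b < 3 - 2 * Num.sqrt 2 ->
  0 <= theta ->
  theta <= (1 - 2 * Num.sqrt (gamma * b) - gamma * b)
           / (1 + 2 * Num.sqrt (gamma * b) + gamma * b) ->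
  let lam := b / (Num.sqrt (gamma * b) + gamma * b) in
  let tstar := (1 + gamma * b - Num.sqrt (1 - 6 * gamma * b + (gamma * b) ^+ 2))
               / (4 * gamma) in
  let taubar := (1 + gamma * b + Num.sqrt (1 - 6 * gamma * b + (gamma * b) ^+ 2))
               / (4 * gamma) in
  let f := fmaj gamma b in
  (* the method is well defined *)
  (forall (k : nat) (x : nat -> X), x 0%N = x0 ->
     (forall j, (j < k)%N -> inexact_step Linv F theta (x j) (x j.+1)) ->
     interior C (x k) /\
     (exists Lk : Y -> X, (forall h, Lk ('d F (x k) h) = h) /\
                          (forall y, 'd F (x k) (Lk y) = y)) /\
     exists S : X, inexact_step Linv F theta (x k) (x k + S)) /\
  (* properties of any generated sequence *)
  (forall x : nat -> X, x 0%N = x0 ->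
     (forall k, inexact_step Linv F theta (x k) (x k.+1)) ->
     exists xs : X,
       x @ \oo --> xs /\ F xs = 0 /\
       (forall k, `|Linv (F (x k))| <= ((1 + theta ^+ 2) / 2) ^+ k * b) /\
       (forall k, ball x0 lam (x k)) /\
       `|xs - x0| <= tstar /\
       (forall y, ball x0 taubar y -> F y = 0 -> y = xs) /\
       (forall k, `|xs - x k.+1| <=
          ((1 + theta) / 2 * (left_deriv (derive1 f) lam / `|derive1 f lam|) * `|xs - x k|
           + theta * ((derive1 f lam + 2) / `|derive1 f lam|)) * `|xs - x k|) /\
       (theta < (1 - 2 * Num.sqrt (gamma * b) - gamma * b)
                / (5 - 2 * Num.sqrt (gamma * b) - gamma * b) ->
        forall k, `|xs - x k.+1| <=
          ((1 + theta) / 2 + 2 * theta / (1 - 2 * Num.sqrt (gamma * b) - gamma * b))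
          * `|xs - x k|)).
Proof.
move=> _ Fan _ LF FL gamma g0 ballC b0 Fb gb th0 th lam tstar taubar f.
have ballI x : ball x0 gamma^-1 x -> interior C x.
  by move: x; rewrite -/(_ `<=` _) -open_subsetE //; exact: ball_open.
have {}Fan x : ball x0 gamma^-1 x -> analytic_at F x by move=> /ballI /Fan.
have dF x : ball x0 gamma^-1 x -> differentiable F x.
  move=> /Fan /analytic_at_expands[a' [K [g [r H]]]].
  have n0 : `|0 : X| < r by rewrite normr0; case: H => -[].
  by have [+ _] := expands_diff H n0; rewrite addr0.
have gi0 : 0 < gamma^-1 by rewrite invr_gt0.
have dFc : continuous ('d F x0) by apply: diff_continuous; exact/dF/ballxx.
have Llin : linear Linv.
  by move=> k u v; apply: (can_inj LF); rewrite linearP !FL.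
pose L : {linear Y -> X} := HB.pack Linv (GRing.isLinear.Build R Y X _ Linv Llin).
have [B [B0 LB]] := bounded_inverse dFc LF FL.
have Lc : continuous L.
  apply: bounded_linear_continuous; apply/linear_boundedP.
  exists B; split; first exact: num_real.
  by move=> r Br v; apply: le_trans (LB v) _; rewrite ler_wpM2r // ltW.
have gb1 := gb_lt1 g0 b0 gb.
have b1 : gamma * `|L (F x0)| <= 1.
  by apply: le_trans (ltW gb1); rewrite ler_pM2l.
have [c [mc gc c1 c0 cE]] := @normalized_expansion R X Y F x0 L g0 Fan Lc LF b1.
pose a := Num.sqrt (gamma * b).
have a0 : 0 < a := sqrt_gb_pos g0 b0.
have a2 : a ^+ 2 = gamma * b := sqr_sqrt_gb g0 b0.
have bE : b = a ^+ 2 / gamma by rewrite a2 mulrAC mulfV ?mul1r // gt_eqF.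
have k0 : 0 < 1 - 2 * a - a ^+ 2 by rewrite a2; exact: kappa_pos.
have th1 : 2 * theta <= (1 - 2 * a - a ^+ 2) * (1 + theta).
  have : 0 < 1 + 2 * a + a ^+ 2 by rewrite !addr_gt0 ?mulr_gt0 ?exprn_gt0.
  by move: th; rewrite -/a -a2 => + h; rewrite ler_pdivlMr //; lra.
have lamE : lam = b / (a + a ^+ 2) by rewrite a2.
have [tl lt] := andP (tstar_lt_lam g0 b0 gb); rewrite -/tstar -/taubar -/lam in tl lt.
have glam : gamma * lam < 1 by rewrite lamE; exact: glam_lt1.
have lam_in x : `|x - x0| <= lam -> `|x - x0| < gamma^-1.
  move=> /le_lt_trans; apply; by rewrite -[_^-1]mulr1 ltr_pdivlMl.
have in_ball x : `|x - x0| < gamma^-1 -> ball x0 gamma^-1 x.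
  by rewrite -ball_normE /= distrC.
pose G := L \o F : X -> X.
have Gb : `|G x0| <= b by exact: Fb.
have GE h : `|h| < gamma^-1 -> G (x0 + h) = psat c h by exact: cE.
have dps_eq x u : `|x - x0| <= lam ->
    differentiable G x /\ L ('d F x u) = dps x0 c x u /\ 'd G x u = dps x0 c x u.
  move=> /lam_in xg; apply: (expands_lin_comp _ _ _ _ cE) => //.
  exact/dF/in_ball.
have stepE x y : `|x - x0| <= lam -> inexact_step Linv F theta x y ->
    `|G x + dps x0 c x (y - x)| <= theta * `|G x|.
  move=> xl; have [_ [<- _]] := dps_eq x (y - x) xl.
  by rewrite /inexact_step -[Linv]/(L : Y -> X) linearD.
(* Strong induction: a residual condition can be rewritten with [dps] only at a point already known
   to lie in the ball, so the step at j uses the claim at j. *)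
have near k x : x 0%N = x0 ->
    (forall j, (j < k)%N -> inexact_step Linv F theta (x j) (x j.+1)) ->
    `|x k - x0| < lam.
  move=> xE; elim/ltn_ind: k => k IH H.
  have [|+ _] := @newton_invariant R X G x0 c gamma b a g0 a0 bE k0 mc gc c1 Gb GE
      theta th0 th1 x k xE.
    move=> j jk; apply: stepE; last exact: H.
    by apply/ltW/IH => // i ij; apply: H; exact: ltn_trans jk.
  move=> /le_lt_trans; apply; rewrite lamE.
  by have [] := majseq_inv g0 a0 bE k0 th0 th1 k.
have L0 y : L y = 0 -> y = 0 by move=> Ly; rewrite -[y]FL -[Linv]/(L : Y -> X) Ly linear0.
have dlam : dfmaj gamma lam = - (1 - 2 * a - a ^+ 2) by rewrite lamE; exact: dfmaj_lam.
have dlam0 : dfmaj gamma lam < 0 by rewrite dlam oppr_lt0.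
split=> [k x xE xN|x xE xN].
  have xl := ltW (near k x xE xN); have xg := lam_in _ xl.
  split; first exact/ballI/in_ball.
  suff [Lk [Lk1 Lk2]] : exists Lk : Y -> X, (forall h, Lk ('d F (x k) h) = h) /\
      (forall y, 'd F (x k) (Lk y) = y).
    split; first by exists Lk.
    (* The exact Newton step has zero residual and is therefore admissible for every tolerance. *)
    exists (Lk (- F (x k))).
    rewrite /inexact_step [_ + _ - _]addrC addKr Lk2 subrr -[Linv]/(L : Y -> X) linear0 normr0.
    by rewrite mulr_ge0.
  have [dG _] := dps_eq (x k) 0 xl.
  have TE u : 'd G (x k) u = dps x0 c (x k) u by have [_ []] := dps_eq (x k) u xl.
  have TL u : 'd G (x k) u = L ('d F (x k) u).
    by rewrite TE; have [_ [-> _]] := dps_eq (x k) u xl.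
  have Tinj u v : 'd G (x k) u = 'd G (x k) v -> u = v.
    move=> e; apply/eqP; rewrite -subr_eq0 -normr_le0.
    have := dps_ge g0 gc c1 (u - v) xl glam.
    by rewrite -TE linearB e subrr normr0 pmulr_rle0 // oppr_gt0.
  (* On the ball of radius lambda the derivative of G differs from the identity by at most
     f'(lambda) + 1 = 1 - kappa < 1. *)
  have Tsurj : forall y, exists h, 'd G (x k) h = y.
    apply: (@neumann R X ('d G (x k)) (dfmaj gamma lam + 1)).
    - exact: diff_continuous.
    - have -> : dfmaj gamma lam + 1 = 2 * a + a ^+ 2 by rewrite dlam; ring.
      by rewrite addr_ge0 ?sqr_ge0 // mulr_ge0 // ltW.
    - by rewrite gtrDr.
    - by move=> h; rewrite TE; exact: (dps_near_id g0 gc c1 h xl glam).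
  have /choice[Lk LkP] : forall y, exists h, 'd G (x k) h = L y by move=> y; exact: Tsurj.
  exists Lk; split=> [h|y]; first by apply: Tinj; rewrite LkP TL.
  by apply: (can_inj FL); have := LkP y; rewrite TL.
have xl k : `|x k - x0| < lam by apply: near => // j _; exact: xN.
have {}xN k : `|G (x k) + dps x0 c (x k) (x k.+1 - x k)| <= theta * `|G (x k)|.
  by apply: stepE => //; exact: ltW.
have [xs xs_lim] := newton_cvg g0 a0 bE k0 mc gc c1 Gb GE th0 th1 xE xN.
have xsl : `|xs - x0| <= lam.
  by rewrite lamE; exact: (newton_lim_ball g0 a0 bE k0 mc gc c1 Gb GE th0 th1 xE xN xs_lim).
have Gxs : G xs = 0 := newton_lim_zero g0 a0 bE k0 mc gc c1 Gb GE th0 th1 xE xN xs_lim.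
(* At the distance of a zero the majorant is nonnegative, and below [taubar] this leaves only
   distances up to [tstar]. *)
have zero_tstar y : `|y - x0| < taubar -> G y = 0 -> `|y - x0| <= tstar.
  move=> yt Gy; apply: (le_tstar g0 b0 gb yt).
  apply: (fmaj_ge0_of_zero g0 mc gc c1 Gb GE _ Gy).
  by apply: lt_trans (gtaubar_lt1 g0 b0 gb); rewrite ltr_pM2l.
have xst : `|xs - x0| <= tstar by apply: zero_tstar => //; exact: le_lt_trans lt.
have dE : derive1 f lam = - (1 - 2 * a - a ^+ 2).
  by rewrite /f derive1_fmaj ?dlam // gt_eqF // subr_gt0.
exists xs; split; first exact: xs_lim.
split; first exact: L0.
split; first exact: (newton_residual g0 a0 bE k0 mc gc c1 Gb GE th0 th1 xE xN).
split; first by move=> k; rewrite -ball_normE /= distrC.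
split; first exact: xst.
split.
  move=> y; rewrite -ball_normE /= distrC => yt Fy.
  have Gy : G y = 0 by rewrite -[G y]/(L (F y)) Fy linear0.
  apply: (zero_unique g0 mc gc c1 GE (t := tstar)) => //; last exact: zero_tstar.
  (* Both zeros lie in the closed ball of radius [tstar] < lambda, where monotonicity of f' gives f'
     < 0 and hence injectivity of G. *)
  - by apply: le_lt_trans dlam0; apply: dfmaj_homo => //; exact: ltW.
  - by apply: lt_trans glam; rewrite ltr_pM2l.
split.
  move=> k; rewrite dE normrN gtr0_norm // left_deriv_fmaj ?subr_gt0 // {1}lamE.
  rewrite one_sub_glam // exprVn invrK [- _ + 2]addrC.
  exact: (newton_quadratic g0 a0 bE k0 mc gc c1 Gb GE th0 th1 xE xN xs_lim).
move=> _ k; rewrite -/a -a2.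
exact: (newton_linear g0 a0 bE k0 mc gc c1 Gb GE th0 th1 xE xN xs_lim).
Qed.
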